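(* Let $(T,o)$ be a hyperfinite unimodular random rooted tree of degree at most $d$. If $T$ is two-ended almost surely, then almost surely its growth $\lim_{n\to\infty}|B_T(o,n)|^{1/n}$ exists and equals $1$. If $T$ is one-ended almost surely, then almost surely its upper growth satisfies $$\limsup_{n\to\infty}|B_T(o,n)|^{1/n}\le\sqrt{d-1},$$ and, by Timár's construction, in this one-ended case the growth $\lim_{n\to\infty}|B_T(o,n)|^{1/n}$ may not exist.
   Context: $B_T(o,n)$ is the set of vertices at graph distance at most $n$ from $o$. A random rooted graph $(G,o)$ of degrees bounded by $d$ is a random element of the space of isomorphism classes of connected rooted graphs with degrees at most $d$ (with the local topology, given by isomorphism of balls around the root). It is unimodular if it satisfies the Mass Transport Principle: for every measurable non-negative function $F$ on (isomorphism classes of) triples $(G,x,y)$, with $G$ a bounded degree connected graph and $x,y\in V(G)$, one has $\mathbb E(\sum_{x\in V(G)}F(G,o,x))=\mathbb E(\sum_{x\in V(G)}F(G,x,o))$, provided one of the sides is finite. A unimodular random rooted tree is a unimodular random rooted graph that is almost surely a tree. An infinite unimodular random rooted tree is hyperfinite if and only if it has one or two ends almost surely (this characterization, due to Aldous and Lyons, may be taken as the definition here). Timár's construction (A. Timár, ''A stationary random graph of no growth rate'', 2014) is a unimodular random rooted tree of bounded degree that is one-ended almost surely, with $\liminf_{n\to\infty}|B_T(o,n)|^{1/n}=1$ and $\limsup_{n\to\infty}|B_T(o,n)|^{1/n}=c$ almost surely for a constant $c>1$. *)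

(* Defs.v *)
From HB Require Import structures.
From mathcomp Require Import all_boot all_order all_algebra.
From mathcomp Require Import finmap.
From mathcomp Require Import all_classical all_reals all_analysis.
From mathcomp Require Import measurable_realfun.

Set Implicit Arguments.
Unset Strict Implicit.
Unset Printing Implicit Defensive.

Import Order.TTheory GRing.Theory Num.Theory.
Import numFieldNormedType.Exports.

Local Open Scope classical_set_scope.
Local Open Scope ring_scope.
Local Open Scope quotient_scope.
Local Open Scope card_scope.

(* Connected simple graphs with all degrees at most D.  Such a graph is
   countable, so up to isomorphism its vertex set is a subset of nat. *)
Record graph (D : nat) := Graph {
  vset : pred nat ;
  adj : rel {v : nat | vset v} ;
  adj_sym : symmetric adj ;
  adj_irr : irreflexive adj ;
  adj_conn : forall x y, exists2 p, path adj x p & last x p = y ;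
  adj_deg : forall x, [set y | adj x y] #<= `I_D }.

Definition vertex (D : nat) (G : graph D) := {v : nat | vset G v}.

Section GraphNotions.
Variables (D : nat) (G : graph D).

(* A walk of length at most n from x to y exists iff dist(x, y) <= n. *)
Definition graph_ball (x : vertex G) (n : nat) : set (vertex G) :=
  [set y | exists p : seq (vertex G),
     [/\ path (@adj D G) x p, last x p = y & (size p <= n)%N]].

Definition is_tree : Prop :=
  ~ exists2 c : seq (vertex G), (2 < size c)%N & ucycle (@adj D G) c.

Definition is_ray (r : nat -> vertex G) : Prop :=
  injective r /\ forall i, adj (r i) (r i.+1).

(* Two rays are equivalent when, for every finite set K of vertices, they have
   tails in the same connected component of G minus K. *)
Definition same_end (r s : nat -> vertex G) : Prop :=
  forall K : seq (vertex G), exists N : nat,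
  forall i j : nat, (N <= i)%N -> (N <= j)%N ->
  exists p : seq (vertex G),
    [/\ path (@adj D G) (r i) p, last (r i) p = s j & ~~ has (mem K) (r i :: p)].

Definition ends : set (set (nat -> vertex G)) :=
  [set [set s | is_ray s /\ same_end r s] | r in is_ray].

End GraphNotions.
Arguments ends {D} G _.

(* Graphs with k distinguished vertices: k = 1 gives the rooted graphs (G, o)
   and k = 2 the triples (G, x, y). *)
Record marked (D k : nat) := Marked {
  graph_of : graph D ;
  marks : k.-tuple (vertex graph_of) }.

HB.instance Definition _ (D k : nat) := gen_eqMixin (marked D k).
HB.instance Definition _ (D k : nat) := gen_choiceMixin (marked D k).

Section Isomorphism.
Variables (D k : nat).

Definition isomorphic (M N : marked D k) : Prop :=
  exists f : vertex (graph_of M) -> vertex (graph_of N),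
    [/\ bijective f, {mono f : x y / adj x y} &
        map_tuple f (marks M) = marks N].

Lemma isomorphic_refl M : isomorphic M M.
Proof.
exists id; split=> //; first by exists id.
by apply/val_inj; rewrite /= map_id.
Qed.

Lemma isomorphic_sym M N : isomorphic M N -> isomorphic N M.
Proof.
move=> [f [[g fK gK] fadj fm]]; exists g; split; first by exists f.
- by move=> x y; rewrite -fadj !gK.
- by apply/val_inj; rewrite -fm /= -map_comp map_id_in// => x _; exact: fK.
Qed.

Lemma isomorphic_trans M N L :
  isomorphic M N -> isomorphic N L -> isomorphic M L.
Proof.
move=> [f [bf fadj fm]] [g [bg gadj gm]]; exists (g \o f); split.
- exact: bij_comp.
- by move=> x y; rewrite /= gadj fadj.
- by apply/val_inj; rewrite -gm -fm /= map_comp.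
Qed.

Definition isomorphicb (M N : marked D k) : bool := `[< isomorphic M N >].

Lemma isomorphicb_refl : reflexive isomorphicb.
Proof. by move=> M; apply/asboolP; exact: isomorphic_refl. Qed.

Lemma isomorphicb_sym : symmetric isomorphicb.
Proof. by move=> M N; apply/asboolP/asboolP; exact: isomorphic_sym. Qed.

Lemma isomorphicb_trans : transitive isomorphicb.
Proof.
move=> N M L /asboolP MN /asboolP NL; apply/asboolP.
exact: isomorphic_trans MN NL.
Qed.

Definition isomorphic_equiv : equiv_rel (marked D k) :=
  EquivRel isomorphicb isomorphicb_refl isomorphicb_sym isomorphicb_trans.

Definition iso_class : Type := {eq_quot isomorphic_equiv}.

HB.instance Definition _ := Choice.on iso_class.
HB.instance Definition _ := Quotient.on iso_class.

End Isomorphism.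

(* Only needed because measurable types are pointed. *)
Section OneVertex.
Variables (D k : nat).

Definition point_vertex : {v : nat | v == 0%N} := exist _ 0%N (eqxx 0%N).

Lemma point_vertexE (x : {v : nat | v == 0%N}) : x = point_vertex.
Proof. by apply/val_inj; case: x => v /= /eqP. Qed.

Lemma point_conn (x y : {v : nat | v == 0%N}) :
  exists2 p, path (fun _ _ => false) x p & last x p = y.
Proof. by exists [::] => //=; rewrite (point_vertexE x) (point_vertexE y). Qed.

Lemma point_deg (x : {v : nat | v == 0%N}) :
  [set y : {v : nat | v == 0%N} | false] #<= `I_D.
Proof.
have -> : [set y : {v : nat | v == 0%N} | false] = set0 by apply/seteqP; split.
exact: card_ge0.
Qed.

Definition point_graph : graph D :=
  @Graph D (fun v => v == 0%N) (fun _ _ => false)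
    (fun _ _ => erefl) (fun _ => erefl) point_conn point_deg.

HB.instance Definition _ := isPointed.Build (iso_class D k)
  (\pi_(iso_class D k)
     (Marked (nseq_tuple k (point_vertex : vertex point_graph)))).

End OneVertex.

Section LocalTopology.
Variables (D k : nat).

Definition marked_ball (M : marked D k) (n : nat) : set (vertex (graph_of M)) :=
  \bigcup_(x in [set` marks M]) graph_ball x n.
Arguments marked_ball M n _ : clear implicits.

(* The graphs induced on the balls of radius n around the marks are isomorphic,
   by an isomorphism respecting the marks. *)
Definition ball_isomorphic (n : nat) (M N : marked D k) : Prop :=
  exists f : vertex (graph_of M) -> vertex (graph_of N),
    [/\ set_bij (marked_ball M n) (marked_ball N n) f,
        forall x y, marked_ball M n x -> marked_ball M n y ->
          adj (f x) (f y) = adj x y &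
        map_tuple f (marks M) = marks N].

(* Basic open sets of the local topology.  Being ball-isomorphic is invariant
   under isomorphism, so the choice of representatives is immaterial. *)
Definition cylinder (cn : iso_class D k * nat) : set (iso_class D k) :=
  [set c | ball_isomorphic cn.2 (repr cn.1) (repr c)].

HB.instance Definition _ :=
  isSubBaseTopological.Build (iso_class D k) [set: iso_class D k * nat] cylinder.

End LocalTopology.

(* Isomorphism classes with the Borel sigma-algebra of the local topology. *)
Definition iso_space (D k : nat) : Type :=
  g_sigma_algebraType (@open (iso_class D k)).

HB.instance Definition _ (D k : nat) := Measurable.on (iso_space D k).

Definition class_of (D k : nat) (G : graph D) (m : k.-tuple (vertex G)) :
  iso_space D k := \pi_(iso_class D k) (Marked m).

(* A representative (G, o) of a class of rooted graphs; everything below is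
   invariant under isomorphism, so its choice is immaterial. *)
Definition rep_graph (D : nat) (c : iso_space D 1) : graph D :=
  graph_of (repr (c : iso_class D 1)).

Definition root (D : nat) (c : iso_space D 1) : vertex (rep_graph c) :=
  thead (marks (repr (c : iso_class D 1))).

Definition one_ended (D : nat) (c : iso_space D 1) : Prop :=
  ends (rep_graph c) #= `I_1.

Definition two_ended (D : nat) (c : iso_space D 1) : Prop :=
  ends (rep_graph c) #= `I_2.

(* The sequence |B(o, n)|^(1/n).  Balls are finite since degrees are bounded,
   so the cardinality is not the default value of fset_set. *)
Definition growth (R : realType) (D : nat) (c : iso_space D 1) (n : nat) : R :=
  (#|` fset_set (graph_ball (root c) n)|)%:R `^ (n%:R^-1).

Section RandomRootedGraph.
Variables (R : realType) (D : nat) (disp : measure_display).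
Variables (Omega : measurableType disp) (P : probability Omega R).
Variable T : {RV P >-> iso_space D 1}.

Local Open Scope ereal_scope.

Definition unimodular : Prop :=
  forall F : iso_space D 2 -> \bar R,
    measurable_fun [set: iso_space D 2] F -> (forall c, 0 <= F c) ->
  let sent := \int[P]_w \esum_(x in [set: vertex (rep_graph (T w))])
                F (class_of [tuple root (T w); x]) in
  let received := \int[P]_w \esum_(x in [set: vertex (rep_graph (T w))])
                F (class_of [tuple x; root (T w)]) in
  (sent < +oo) || (received < +oo) -> sent = received.

Definition unimodular_tree : Prop :=
  unimodular /\ {ae P, forall w, is_tree (rep_graph (T w))}.

(* The Aldous-Lyons characterization of hyperfiniteness of infinite unimodular
   random rooted trees, taken as the definition. *)
Definition hyperfinite_tree : Prop :=
  {ae P, forall w, one_ended (T w) \/ two_ended (T w)}.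

End RandomRootedGraph.

(* Main.v *)
From Stdlib Require PeanoNat.
Require Import Defs.
From HB Require Import structures.
From mathcomp Require Import all_boot all_order all_algebra.
From mathcomp Require Import finmap.
From mathcomp Require Import all_classical all_reals all_analysis.
From mathcomp Require Import measurable_realfun.
From mathcomp Require Import zify lra.
Set Implicit Arguments.
Unset Strict Implicit.
Unset Printing Implicit Defensive.
Import Order.TTheory GRing.Theory Num.Theory.
Import numFieldNormedType.Exports.
Local Open Scope classical_set_scope.
Local Open Scope ring_scope.

(** Mass transport proves the two upper bounds, and an explicit tree the last claim.

    Both bounds come from the mass transport principle. Let every vertex send
    mass 1 to the vertices related to it by some measurable relation. If no vertex
    sends mass more than [C], then the expected mass received is at most [C]; if
    moreover a root with a large ball receives a lot of mass, Markov's inequality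
    bounds the probability of a large ball ([mass_transport_bound]), and the
    Borel-Cantelli lemma turns summable bounds for the radii [n] into an almost
    sure statement ([ae_eventually_not]).

    In a one-ended tree every vertex has a parent, its neighbour in the direction
    of the end, and at most [d - 1] children. A vertex [y] of the ball of radius
    [n] around [x] is obtained by climbing [j] steps from [x] and descending [k]
    steps, with [j + k <= n] ([ball_confluent]). There are at most [(d - 1) ^ k]
    such [y] for given [j] and [k], which settles the pairs with [k <= j], where
    [k <= n / 2]. For [j < k] the roles are exchanged by mass transport: [y] sends
    mass to [x], and since [x] is found from [y] by a descent of only [j] steps, the
    mass sent is again at most a polynomial times [(d - 1) ^ (n / 2)]
    ([confluent_from], [confluent_to]). Hence balls of radius [n] eventually have
    at most polynomially more than [sqrt (d - 1) ^ n] vertices.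

    In a two-ended tree the edges with two infinite sides form a bi-infinite path,
    the trunk, and the other edges form finite bushes along it. A walk of length
    [n] meets at most [2 n + 2] bushes, in which, if each vertex sends mass only to
    bushes with at most [k] vertices, it sends mass at most [(2 n + 2) k]
    ([cheap_walks_listed]). A root whose bush has at most [k] vertices receives
    mass from its whole ball. So balls eventually have polynomial size.

    The relations used have to be measurable. They are built from the property
    that one side of an edge is finite, which is witnessed by a finite set of
    vertices, hence visible in a large ball; such local properties are open in the
    local topology ([local_measurable]).

    The example without growth rate is a canopy tree: one end, and at each height
    [h] all vertices alike, with one or two children according to a fixed pattern.
    Choosing the height of the root with probability proportional to
    [2 ^ - level h], where [level h] is the number of branching heights below [h],
    makes it unimodular, because the tree has automorphisms acting transitively
    on each height ([level_transport]). The pattern has a block of branching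
    heights between [L] and [2 L], for [L] a power of 16, and no branching up to
    the next block. For large [L], the ball of the root of radius [3 L] contains at
    least [2 ^ L] vertices, and the one of radius [14 L] at most [2 ^ (3 L)]: the
    growth is at least [2 ^ (1/3)] infinitely often and at most [2 ^ (3/14)]
    infinitely often. *)

(** * Walks and the two sides of an edge of a tree *)
Lemma sym_path_rev (T : eqType) (R : rel T) (x : T) (p : seq T) :
  symmetric R -> path R x p ->
  exists q, [/\ path R (last x p) q, last (last x p) q = x
             & last x p :: q =i x :: p].
Proof.
move=> symR xp; exists (rev (belast x p)); split.
- by rewrite rev_path; under eq_path do rewrite symR.
- by case: p {xp} => //= y p; rewrite rev_cons last_rcons.
- by move=> z; rewrite (lastI x) mem_rcons !inE mem_rev.
Qed.

Section Trees.
Variables (D : nat) (G : graph D).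
Local Notation V := (vertex G).
Local Notation e := (@adj D G).
Implicit Types (u v w x y z : V) (p q : seq V) (r s : nat -> V).

Lemma adjC x y : e x y = e y x. Proof. exact: adj_sym. Qed.

Lemma adj_neq x y : e x y -> x != y.
Proof. by apply: contraTneq => ->; rewrite adj_irr. Qed.

Lemma walk_rev x p : path e x p ->
  exists q, [/\ path e (last x p) q, last (last x p) q = x
             & last x p :: q =i x :: p].
Proof. exact: sym_path_rev adjC. Qed.

(** In a tree with an edge [v w] this is the part attached to [v] once the edge
    is cut. Walks avoiding the vertex [w] are used instead of walks avoiding the
    edge, so that everything is a condition on lists of vertices. *)
Definition side v w : set V :=
  [set u | exists p, [/\ path e v p, last v p = u & w \notin v :: p]].

Lemma side_refl v w : v != w -> side v w v.
Proof. by move=> vw; exists [::]; rewrite /= inE eq_sym. Qed.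

Lemma side_notin v w u : side v w u -> u != w.
Proof.
by move=> [p [_ <- wp]]; apply: contraNneq wp => <-; exact: mem_last.
Qed.

Hypothesis treeG : is_tree G.

(** A second edge from [side v w] to [w] would close a cycle through [w] and [v]. *)
Lemma tree_no_chord v w u :
  e v w -> side v w u -> u != v -> ~~ e u w.
Proof.
move=> vw [p [vp <- wp]] pv; apply/negP => puw; apply: treeG.
case: (shortenP vp) pv puw => p' vp' Up' p'p pv puw.
have wp' : w \notin v :: p'.
  apply: contra wp; rewrite !inE => /orP[->//|/p'p ->]; exact: orbT.
exists [:: w, v & p']; first by case: p' pv {vp' Up' p'p puw wp'} => //=; rewrite eqxx.
by rewrite /ucycle /= rcons_path vp' puw adjC vw wp'.
Qed.

(** The only edge leaving a side is the one that was cut. *)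
Lemma side_step v w u u' : e v w -> side v w u -> e u u' ->
  side v w u' \/ (u = v /\ u' = w).
Proof.
move=> vw su uu'; have [u'w|u'w] := eqVneq u' w.
  have [uv|uv] := eqVneq u v; first by right.
  by have := tree_no_chord vw su uv; rewrite -u'w uu'.
left; case: su => p [vp pu wp]; exists (rcons p u'); split.
- by rewrite rcons_path vp pu.
- by rewrite last_rcons.
- by rewrite -rcons_cons mem_rcons inE negb_or eq_sym u'w.
Qed.

(** To leave the side of [v], a walk has to use the cut edge, hence to visit [v]. *)
Lemma side_walk v w u q : e v w -> side v w u -> path e u q ->
  v \notin u :: q -> {in u :: q, forall x, side v w x}.
Proof.
move=> vw; elim: q u => [|u' q IHq] u su /=.
  by move=> _ _ x; rewrite inE => /eqP ->.
move=> /andP[uu' u'q]; rewrite inE negb_or => /andP[vu vq] x.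
rewrite inE => /orP[/eqP -> //|]; apply: IHq => //.
by case: (side_step vw su uu') => // -[uv]; rewrite uv eqxx in vu.
Qed.

(** A common vertex gives a walk to [w] that avoids [v], hence stays in
    [side v w]; but [w] is not there. *)
Lemma side_disjoint v w u : e v w -> side v w u -> side w v u -> False.
Proof.
move=> vw su [p [wp pu vp]]; have [q [uq qw quv]] := walk_rev wp.
rewrite pu in uq qw quv.
have vq : v \notin u :: q by rewrite quv.
have := side_walk vw su uq vq (mem_last u q).
by rewrite qw => /side_notin; rewrite eqxx.
Qed.

Lemma side_cover v w u : e v w -> side v w u \/ side w v u.
Proof.
move=> vw; have [p vp <-] := adj_conn v u.
have wv : e w v by rewrite adjC.
elim/last_ind: p vp => [|p x IHp]; first by left; exact/side_refl/adj_neq.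
rewrite rcons_path last_rcons => /andP[/IHp{}IHp px].
case: IHp => IHp.
  have [|[_ ->]] := side_step vw IHp px; first by left.
  by right; exact/side_refl/adj_neq.
have [|[_ ->]] := side_step wv IHp px; first by right.
by left; exact/side_refl/adj_neq.
Qed.

Lemma side_nest v w u : e v w -> e u v -> u != w -> side u v `<=` side v w.
Proof.
move=> vw uv uw x [q [uq <- vq]].
have su : side v w u.
  exists [:: u]; rewrite /= adjC uv !inE negb_or; split=> //.
  by rewrite eq_sym (eq_sym w) adj_neq.
exact: (side_walk vw su uq vq (mem_last u q)).
Qed.

(** * Rays and ends *)
Lemma ray_leaves r (K : seq V) : is_ray r ->
  exists N, forall i, (N <= i)%N -> r i \notin K.
Proof.
move=> [rinj _]; elim: K => [|x K [N HN]]; first by exists 0%N.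
have [[j rj]|xr] := pselect (exists j, r j = x).
  exists (maxn N j.+1) => i; rewrite geq_max inE negb_or => /andP[Ni ji].
  rewrite HN // andbT -rj; apply/eqP => /rinj ij; by rewrite ij ltnn in ji.
exists N => i Ni; rewrite inE negb_or HN// andbT.
by apply/eqP => rix; apply: xr; exists i.
Qed.

Lemma ray_walk r i j : is_ray r -> (i <= j)%N ->
  exists p, [/\ path e (r i) p, last (r i) p = r j
             & {in r i :: p, forall x, exists2 k, (i <= k)%N & x = r k}].
Proof.
move=> [_ radj]; elim: j => [|j IHj].
  rewrite leqn0 => /eqP ->; exists [::]; split=> // x; rewrite inE => /eqP ->.
  by exists 0%N.
rewrite leq_eqVlt => /orP[/eqP ->|].
  exists [::]; split=> // x; rewrite inE => /eqP ->; by exists j.+1.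
rewrite ltnS => ij; have [p [ip pj Hp]] := IHj ij.
exists (rcons p (r j.+1)); split.
- by rewrite rcons_path ip pj radj.
- by rewrite last_rcons.
- move=> x; rewrite -rcons_cons mem_rcons inE => /orP[/eqP ->|]; last exact: Hp.
  by exists j.+1 => //; rewrite ltnW.
Qed.

(** Reflexivity has content: a ray must leave every finite set, because it does
    not repeat vertices. *)
Lemma same_end_refl r : is_ray r -> same_end r r.
Proof.
move=> rr K; have [N HN] := ray_leaves K rr; exists N => i j Ni Nj.
suff H a b : (N <= a)%N -> (a <= b)%N -> exists p,
    [/\ path e (r a) p, last (r a) p = r b & ~~ has (mem K) (r a :: p)].
  have [ij|/ltnW ji] := leqP i j; first exact: H.
  have [p [jp pi HK]] := H _ _ Nj ji.
  have [q [iq qj qp]] := walk_rev jp; rewrite pi in iq qj qp.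
  exists q; split=> //; apply: contra HK => /hasP[x]; rewrite qp => xp xK.
  by apply/hasP; exists x.
move=> Na ab; have [p [ap pb Hp]] := ray_walk rr ab; exists p; split=> //.
apply/hasPn => x /Hp[k ak ->]; exact/HN/(leq_trans Na).
Qed.

Lemma same_end_sym r s : same_end r s -> same_end s r.
Proof.
move=> rs K; have [N HN] := rs K; exists N => i j Ni Nj.
have [p [jp pi HK]] := HN _ _ Nj Ni.
have [q [iq qj qp]] := walk_rev jp; rewrite pi in iq qj qp.
exists q; split=> //; apply: contra HK => /hasP[x]; rewrite qp => xp xK.
by apply/hasP; exists x.
Qed.

Lemma same_end_trans r s t : same_end r s -> same_end s t -> same_end r t.
Proof.
move=> rs st K; have [N HN] := rs K; have [M HM] := st K.
exists (maxn N M) => i j; rewrite !geq_max => /andP[Ni Mi] /andP[Nj Mj].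
have [p [ip pj pK]] := HN i j Ni Nj.
have [q [jq qj qK]] := HM j j Mj Mj.
exists (p ++ q); split.
- by rewrite cat_path ip pj.
- by rewrite last_cat pj.
- rewrite -cat_cons has_cat negb_or pK /=.
  by apply: contra qK => /= ->; rewrite orbT.
Qed.

Lemma ray_adj r i : is_ray r -> e (r i) (r i.+1). Proof. by case. Qed.

(** A walk between the two rays far out has to cross the edge, so the set made of
    the single vertex [v] separates them. *)
Lemma opposite_sides_ends r s v w N M : e v w ->
  (forall i, (N <= i)%N -> side v w (r i)) ->
  (forall i, (M <= i)%N -> side w v (s i)) -> ~ same_end r s.
Proof.
move=> vw Hr Hs rs; have [L HL] := rs [:: v].
pose i := maxn L (maxn N M).
have [Li [Ni Mi]] : (L <= i)%N /\ (N <= i)%N /\ (M <= i)%N by rewrite /i; lia.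
have [p [ip pi pv]] := HL i i Li Li.
have vp : v \notin r i :: p.
  by apply: contra pv => vp; apply/hasP; exists v => //=; rewrite inE eqxx.
have := side_walk vw (Hr i Ni) ip vp (mem_last _ _).
rewrite pi => sv; exact: (side_disjoint vw sv (Hs i Mi)).
Qed.

(** * The direction of a ray *)
(** Rays play the part of ends here: in a tree, a ray eventually stays on one side
    of each edge, and at each vertex exactly one edge leads to its end. This makes
    an end into a parent function. *)
Definition toward r v w :=
  e v w /\ exists N, forall i, (N <= i)%N -> side w v (r i).

Lemma ray_stays r v w i : e v w -> is_ray r ->
  (forall j, (i <= j)%N -> r j != w) -> side v w (r i) ->
  forall j, (i <= j)%N -> side v w (r j).
Proof.
move=> vw rr rw si; elim=> [|j IHj]; first by rewrite leqn0 => /eqP <-.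
rewrite leq_eqVlt => /orP[/eqP <- //|ij].
have [//|[_ jw]] := side_step vw (IHj ij) (ray_adj j rr).
by have := rw j.+1 (ltnW ij); rewrite jw eqxx.
Qed.

Lemma toward_total r v w : is_ray r -> e v w -> toward r v w \/ toward r w v.
Proof.
move=> rr vw; have [N HN] := ray_leaves [:: v; w] rr.
have wv : e w v by rewrite adjC.
have [Hv Hw] : (forall j, (N <= j)%N -> r j != v) /\
               (forall j, (N <= j)%N -> r j != w).
  by split=> j /HN; rewrite !inE negb_or => /andP[].
case: (side_cover (r N) vw) => sN.
  by right; split=> //; exists N; exact: ray_stays sN.
by left; split=> //; exists N; exact: ray_stays sN.
Qed.

Lemma toward_asym r v w : toward r v w -> toward r w v -> False.
Proof.
move=> [vw [N HN]] [_ [M HM]].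
exact: (side_disjoint vw (HM (maxn N M) (leq_maxr _ _))
                         (HN (maxn N M) (leq_maxl _ _))).
Qed.

Lemma toward_uniq r v w w' : toward r v w -> toward r v w' -> w = w'.
Proof.
move=> [vw [N HN]] [vw' [M HM]]; apply/eqP; apply: contraT => ww'.
have wv : e w v by rewrite adjC.
have := side_nest vw' wv ww' (HN (maxn N M) (leq_maxl _ _)).
by move=> H; case: (side_disjoint vw' H (HM (maxn N M) (leq_maxr _ _))).
Qed.

(** The first step of a simple walk from [v] to a far vertex of the ray. *)
Lemma toward_ex r v : is_ray r -> exists w, toward r v w.
Proof.
move=> rr; have [N HN] := ray_leaves [:: v] rr.
have Hv j : (N <= j)%N -> r j != v by move=> /HN; rewrite inE.
have [p vp] := adj_conn v (r N).
case: (shortenP vp) => -[|w q] /=.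
  by move=> _ _ _ vN; have := Hv N (leqnn N); rewrite -vN eqxx.
move=> /andP[vw wq] /andP[vwq _] _ qN; exists w; split=> //.
exists N; apply: ray_stays => //; first by rewrite adjC.
by exists q.
Qed.

(** * Koenig's lemma on one side of an edge *)
Lemma nbrs_ex x : exists s : seq V,
  [/\ uniq s, forall y, (y \in s) = e x y & (size s <= D)%N].
Proof.
have le := adj_deg x; have fin := card_le_finite le (finite_II D).
exists (fset_set [set y | e x y] : seq _); split.
- exact: fset_uniq.
- by move=> y; rewrite in_fset_set //; apply/idP/idP => [/set_mem//|xy]; exact/mem_set.
have /pcard_leP[f] := le.
rewrite -(size_map f) -[D in (_ <= D)%N](size_iota 0); apply: uniq_leq_size.
  rewrite map_inj_in_uniq ?fset_uniq // => a b.
  rewrite !in_fset_set // => aA bA; exact: ('inj_f aA bA).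
move=> _ /mapP[y yA ->]; rewrite mem_iota add0n /=.
have : y \in [set y | e x y] by move: yA; rewrite in_fset_set.
by rewrite inE => /(@funS _ _ _ _ f).
Qed.

Definition nbrs x : seq V := projT1 (cid (nbrs_ex x)).

Lemma nbrs_uniq x : uniq (nbrs x).
Proof. by rewrite /nbrs; case: cid => ? []. Qed.
Lemma mem_nbrs x y : (y \in nbrs x) = e x y.
Proof. by rewrite /nbrs; case: cid => ? []. Qed.
Lemma size_nbrs x : (size (nbrs x) <= D)%N.
Proof. by rewrite /nbrs; case: cid => ? []. Qed.

(** Finiteness witnessed by a list, the form that the certificates of [fin_side]
    and the counting arguments need. *)
Definition listed (A : set V) := exists l : seq V, forall x, A x -> x \in l.

Lemma listed_bigcup (s : seq V) (F : V -> set V) :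
  (forall u, u \in s -> listed (F u)) ->
  listed [set x | exists2 u, u \in s & F u x].
Proof.
elim: s => [|u s IHs] Hs; first by exists [::] => x [].
have [|l Hl] := IHs; first by move=> v vs; apply: Hs; rewrite inE vs orbT.
have [k Hk] := Hs u (mem_head _ _).
exists (k ++ l) => x [v]; rewrite inE mem_cat => /orP[/eqP ->/Hk -> //|vs Fx].
by rewrite Hl ?orbT //; exists v.
Qed.

Lemma side_split v w x : side v w x ->
  x = v \/ exists u, [/\ e v u, u != w & side u v x].
Proof.
move=> [p [vp <- wp]]; case: (shortenP vp) => -[|u q] /=; first by left.
move=> /andP[vu uq] /andP[vuq _] sub; right; exists u; split=> //.
- apply: contraNneq wp => <-; rewrite inE sub ?mem_head ?orbT //.
- by exists q.
Qed.

(** A side is its root together with finitely many smaller sides. *)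
Lemma infinite_side_step v w : ~ listed (side v w) ->
  exists u, [/\ e v u, u != w & ~ listed (side u v)].
Proof.
move=> inf; apply: contrapT => none; apply: inf.
have : forall u, u \in [seq u <- nbrs v | u != w] -> listed (side u v).
  move=> u; rewrite mem_filter mem_nbrs => /andP[uw vu].
  by apply: contrapT => nl; apply: none; exists u.
move=> /listed_bigcup[l Hl]; exists (v :: l) => x /side_split[->|].
  exact: mem_head.
move=> [u [vu uw su]]; rewrite inE Hl ?orbT //; exists u => //.
by rewrite mem_filter uw mem_nbrs.
Qed.

(** Iterating the previous step gives a walk whose sides are nested; each side
    excludes the earlier vertices, so the walk is a ray. *)
Lemma infinite_side_ray v w : e v w -> ~ listed (side v w) ->
  exists2 r, is_ray r & forall i, side v w (r i).
Proof.
move=> vw inf.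
pose good (a : V * V) := e a.1 a.2 /\ ~ listed (side a.1 a.2).
have step (a : {a | good a}) : exists b : {b | good b},
    (sval b).2 = (sval a).1 /\ (sval b).1 != (sval a).2.
  case: a => -[a1 a2] [/= a12 infa].
  have [u [a1u ua2 infu]] := infinite_side_step infa.
  by exists (exist _ (u, a1) (conj (etrans (adjC _ _) a1u) infu)).
pose f a := projT1 (cid (step a)).
have f2 a : (sval (f a)).2 = (sval a).1 by rewrite /f; case: cid => ? [].
have f1 a : (sval (f a)).1 != (sval a).2 by rewrite /f; case: cid => ? [].
pose st i := iter i f (exist _ (v, w) (conj vw inf)).
pose S i := side (sval (st i)).1 (sval (st i)).2.
have stadj i : e (sval (st i)).1 (sval (st i)).2 by case: (svalP (st i)).
have Ssub1 i : S i.+1 `<=` S i.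
  rewrite /S /= -/(st i) f2; apply: side_nest; [exact: stadj| |exact: f1].
  by have := stadj i.+1; rewrite /= -/(st i) f2.
have Ssub i j : (i <= j)%N -> S j `<=` S i.
  elim: j => [|j IHj]; first by rewrite leqn0 => /eqP ->.
  rewrite leq_eqVlt => /orP[/eqP ->//|/IHj H]; exact: (subset_trans (@Ssub1 j) H).
have Sin i : S i (sval (st i)).1 by apply: side_refl; exact/adj_neq/stadj.
exists (fun i => (sval (st i)).1); last by move=> i; exact: (Ssub 0%N i _ _ (Sin i)).
split; last by move=> i; have := stadj i.+1; rewrite /= -/(st i) f2 adjC.
have lt i j : (i < j)%N -> (sval (st i)).1 != (sval (st j)).1.
  move=> ij; have := side_notin (Ssub _ _ ij _ (Sin j)).
  by rewrite /= -/(st i) f2 eq_sym.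
move=> i j ij; have [/lt|/lt|//] := ltngtP i j; by rewrite ij eqxx.
Qed.

(** * Edges with a finite side *)

(** The side of [v] is finite. Finiteness is expressed by a finite set that only
    the edge [v w] leaves, because such a set is visible in a large enough ball:
    this makes [fin_side] an open condition in the local topology. *)
Definition fin_side v w := e v w /\ exists S : seq V, [/\ v \in S, w \notin S &
  forall u u', u \in S -> e u u' -> u' \in S \/ (u = v /\ u' = w)].

Lemma fin_sideP v w : fin_side v w <-> e v w /\ listed (side v w).
Proof.
split=> [[vw [S [vS wS clS]]]|[vw [S HS]]].
  split=> //; exists S => x [p [vp <- wp]].
  elim/last_ind: p vp wp => [//|p y IHp]; rewrite rcons_path last_rcons.
  move=> /andP[vp py]; rewrite -rcons_cons mem_rcons inE negb_or => /andP[wy wp].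
  by have [//|[_ yw]] := clS _ _ (IHp vp wp) py; rewrite yw eqxx in wy.
split=> //; exists [seq x <- S | `[< side v w x >]].
have inS x : side v w x -> x \in [seq x <- S | `[< side v w x >]].
  by move=> sx; rewrite mem_filter HS // andbT; exact/asboolP.
split.
- exact/inS/side_refl/adj_neq.
- rewrite mem_filter negb_and; apply/orP; left; apply/asboolP => /side_notin.
  by rewrite eqxx.
- move=> u u'; rewrite mem_filter => /andP[/asboolP su _] uu'.
  by have [/inS|] := side_step vw su uu'; [left|right].
Qed.

(** [r] and [s] represent all ends; they are equal in the one-ended case. *)
Definition ends_among r s := [/\ is_ray r, is_ray s &
  forall t, is_ray t -> same_end r t \/ same_end s t].

(** A finite side contains no ray, so every ray goes to the other side. *)
Lemma fin_side_toward r v w : is_ray r -> fin_side v w -> toward r v w.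
Proof.
move=> rr /fin_sideP[vw [S HS]]; have [//|[_ [N HN]]] := toward_total rr vw.
have [M HM] := ray_leaves S rr.
have := HM _ (leq_maxr N M); by rewrite HS //; exact/HN/leq_maxl.
Qed.

(** If all ends lie beyond [w], an infinite side of [v] would contain, by Koenig's
    lemma, a ray equivalent to none of them. *)
Lemma toward_fin_side r s v w : ends_among r s ->
  toward r v w -> toward s v w -> fin_side v w.
Proof.
move=> [rr rs all] [vw [N HN]] [_ [M HM]]; apply/fin_sideP; split=> //.
apply: contrapT => /(infinite_side_ray vw)[t rt tv].
have [/same_end_sym rt'|/same_end_sym st] := all t rt.
- exact: (opposite_sides_ends (N := 0) vw (fun i _ => tv i) HN rt').
- exact: (opposite_sides_ends (N := 0) vw (fun i _ => tv i) HM st).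
Qed.

(** * Separating two rays by an edge *)
Lemma side_members v w p : path e v p -> w \notin v :: p ->
  {in v :: p, forall x, side v w x}.
Proof.
elim/last_ind: p => [|p y IHp] vp wp x.
  by rewrite inE => /eqP ->; exists [::].
rewrite -rcons_cons mem_rcons inE => /orP[/eqP ->|].
  by exists (rcons p y); rewrite last_rcons.
move: vp wp; rewrite rcons_path -rcons_cons mem_rcons inE negb_or.
by move=> /andP[vp _] /andP[_ wp]; exact: IHp.
Qed.

Lemma toward_self r n : is_ray r -> toward r (r n) (r n.+1).
Proof.
move=> rr; have [rinj _] := rr; split; first exact: ray_adj.
exists n.+1; apply: ray_stays => //.
- by rewrite adjC ray_adj.
- by move=> j nj; apply/eqP => /rinj jn; rewrite jn ltnn in nj.
- by apply: side_refl; rewrite eq_sym; exact/adj_neq/ray_adj.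
Qed.

Lemma ray_start_side r n : is_ray r -> side (r n) (r n.+1) (r 0%N).
Proof.
move=> rr; have [rinj _] := rr; elim: n => [|n IHn].
  exact/side_refl/adj_neq/ray_adj.
apply: side_nest IHn; rewrite ?ray_adj //.
by apply/eqP => /rinj; lia.
Qed.

(** The sides cut off by the successive edges of a ray decrease to the empty set:
    a fixed walk from the start of the ray to [x] must visit every vertex of the
    ray beyond which [x] lies. *)
Lemma ray_sides_vanish r (K : seq V) : is_ray r ->
  exists N, forall n x, (N <= n)%N -> x \in K -> ~ side (r n.+1) (r n) x.
Proof.
move=> rr; elim: K => [|k K [N HN]]; first by exists 0%N.
have [p rp pk] := adj_conn (r 0%N) k.
have [M HM] := ray_leaves (r 0%N :: p) rr.
exists (maxn N M) => n x; rewrite geq_max => /andP[Nn Mn].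
rewrite inE => /orP[/eqP ->|xK]; last exact: HN.
move=> sk; apply: (side_disjoint (ray_adj n rr) _ sk).
by apply: (side_walk _ (ray_start_side n rr) rp (HM n Mn)); rewrite ?ray_adj // -pk mem_last.
Qed.

(** Otherwise [s] follows [r] across every edge of [r]. Far enough, the part cut
    off by such an edge misses a given finite set and contains tails of both rays,
    which are then joined outside this set. *)
Lemma separating_edge r s : is_ray r -> is_ray s -> ~ same_end r s ->
  exists v w, toward r v w /\ toward s w v.
Proof.
move=> rr rs nrs; apply: contrapT => none; apply: nrs => K.
have [N HN] := ray_sides_vanish K rr.
have [vw [M HM]] := toward_self N rr.
have [_ [M' HM']] : toward s (r N) (r N.+1).
  have [//|t] := toward_total rs vw.
  by case: none; exists (r N), (r N.+1); split=> //; exact: toward_self.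
exists (maxn M M') => i j; rewrite !geq_max => /andP[/HM ri _] /andP[_ /HM' sj].
have avoid p : path e (r N.+1) p -> r N \notin r N.+1 :: p ->
    ~~ has (mem K) (r N.+1 :: p).
  move=> vp wp; apply/hasPn => x /(side_members vp wp) sx; apply/negP => xK.
  exact: HN (leqnn N) xK sx.
have [p [vp pi /(avoid _ vp) pK]] := ri; have [q [vq qj /(avoid _ vq) qK]] := sj.
have [p' [ip' p'v p'p]] := walk_rev vp; rewrite pi in ip' p'v p'p.
exists (p' ++ q); split.
- by rewrite cat_path ip' p'v.
- by rewrite last_cat p'v.
- rewrite -cat_cons has_cat negb_or; apply/andP; split.
    by apply: contra pK => /hasP[x]; rewrite p'p => xp xK; apply/hasP; exists x.
  by apply: contra qK => /= ->; rewrite orbT.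
Qed.

End Trees.

Section Ends.
Variables (D : nat) (G : graph D).
Local Notation V := (vertex G).
Implicit Types r s t : nat -> V.

Let end_class r : set (nat -> V) := [set s | is_ray s /\ same_end r s].

Lemma end_classP r s : is_ray s -> end_class r = end_class s <-> same_end r s.
Proof.
move=> rs; split=> [er|ers].
  have : end_class s s by split=> //; exact: same_end_refl.
  by rewrite -er => -[].
apply/seteqP; split=> t [rt et]; split=> //.
- exact: same_end_trans (same_end_sym ers) et.
- exact: same_end_trans ers et.
Qed.

Lemma one_end_ray : (ends G #= `I_1)%card -> exists r, ends_among r r.
Proof.
rewrite card_eq_sym => /card_set_bijP[f [fun_f _ surj_f]].
have [r rr fr] : ends G (f 0%N) by apply: fun_f.
exists r; split=> // t rt; left.
have /surj_f[i] : ends G (end_class t) by exists t.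
case: i => // _ ft; apply/(end_classP r rt); by rewrite /end_class fr.
Qed.

Lemma two_end_rays : (ends G #= `I_2)%card ->
  exists r s, ends_among r s /\ ~ same_end r s.
Proof.
rewrite card_eq_sym => /card_set_bijP[f [fun_f inj_f surj_f]].
have [r rr fr] : ends G (f 0%N) by apply: fun_f.
have [s rs fs] : ends G (f 1%N) by apply: fun_f.
exists r, s; split; last first.
  move=> /(end_classP r rs); rewrite /end_class fr fs => /inj_f.
  by rewrite !inE => /(_ isT isT).
split=> // t rt.
have /surj_f[i] : ends G (end_class t) by exists t.
case: i => [|[|//]] _ ft; [left|right]; apply/(end_classP _ rt).
- by rewrite /end_class fr.
- by rewrite /end_class fs.
Qed.

End Ends.

(** * Properties visible in a ball *)
Section Locality.
Variables (D k' : nat).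
Local Notation k := k'.+1.
Implicit Types (M N : marked D k) (m n : nat).
Local Notation V M := (vertex (graph_of M)).
Local Notation e := (@adj D _).

(** The witnesses of [ball_isomorphic], named so that one map can transfer several
    facts at once. *)
Definition iso_on n M N (f : V M -> V N) :=
  [/\ set_bij (marked_ball (M := M) n) (marked_ball (M := N) n) f,
      forall x y, marked_ball (M := M) n x -> marked_ball n y ->
        e (f x) (f y) = e x y &
      map_tuple f (marks M) = marks N].

Lemma iso_on_mark n M N (f : V M -> V N) i :
  iso_on n f -> f (tnth (marks M) i) = tnth (marks N) i.
Proof. by move=> [_ _ <-]; rewrite tnth_map. Qed.

Lemma ball0 M (x : V M) : marked_ball 0 x <-> exists i, x = tnth (marks M) i.
Proof.
split=> [[y /tnthP[i yi] [p [_ px]]]|[i ->]].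
  by rewrite leqn0 size_eq0 => /eqP p0; exists i; rewrite -px p0 -yi.
exists (tnth (marks M) i); first exact: mem_tnth.
by exists [::].
Qed.

Lemma ballS M m (x : V M) : marked_ball m.+1 x <->
  marked_ball m x \/ exists2 y : V M, marked_ball m y & e y x.
Proof.
split=> [[z zM [p [zp px]]]|[[z zM [p [zp px pm]]]|[y [z zM [p [zp py pm]]] yx]]].
- rewrite leq_eqVlt => /orP[/eqP|pm]; last by left; exists z => //; exists p.
  case/lastP: p zp px => // p y; rewrite rcons_path last_rcons size_rcons.
  move=> /andP[zp py] <- [pm]; right; exists (last z p) => //.
  by exists z => //; exists p; rewrite pm.
- by exists z => //; exists p; rewrite leqW.
- exists z => //; exists (rcons p x).
  by rewrite rcons_path last_rcons size_rcons zp py yx.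
Qed.

Lemma ball_mono M m n (x : V M) :
  (m <= n)%N -> marked_ball m x -> marked_ball n x.
Proof.
by move=> mn [z zM [p [zp px pm]]]; exists z => //; exists p; rewrite (leq_trans pm).
Qed.

Lemma ball_list M (l : seq (V M)) :
  exists m, forall x, x \in l -> marked_ball m x.
Proof.
elim: l => [|y l [m Hm]]; first by exists 0%N.
have [p mp py] := adj_conn (tnth (marks M) ord0) y.
exists (maxn m (size p)) => x; rewrite inE => /orP[/eqP ->|/Hm].
  exists (tnth (marks M) ord0); first exact: mem_tnth.
  by exists p; rewrite leq_maxr.
exact/ball_mono/leq_maxl.
Qed.

Section Transfer.
Variables (n : nat) (M N : marked D k) (f : V M -> V N).
Hypothesis ison : iso_on n f.

Lemma iso_on_ball m x : (m <= n)%N -> marked_ball m x -> marked_ball m (f x).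
Proof.
elim: m x => [|m IHm] x mn.
  by move=> /ball0[i ->]; apply/ball0; exists i; rewrite (iso_on_mark i ison).
move=> /ballS[xm|[y ym yx]]; apply/ballS; first by left; apply: IHm => //; exact: ltnW.
right; exists (f y); first by apply: IHm => //; exact: ltnW.
have [_ -> //] := ison; first exact: ball_mono (ltnW mn) ym.
by apply: (ball_mono mn); apply/ballS; right; exists y.
Qed.

(** Strictly inside the ball, a ball isomorphism reflects edges to arbitrary
    vertices, since all neighbours still lie in the ball. *)
Lemma iso_on_lift m x y' : (m < n)%N -> marked_ball m x -> e (f x) y' ->
  exists2 y, e x y & f y = y'.
Proof.
move=> mn xm xy'; have [[fun_f _ surj_f] fadj _] := ison.
have [|y yn yy'] := surj_f y'.
  apply: (ball_mono mn); apply/ballS; right; exists (f x) => //.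
  exact: iso_on_ball (ltnW mn) xm.
exists y => //; rewrite -fadj ?yy' //; exact: ball_mono (ltnW mn) xm.
Qed.

Lemma iso_on_inj x y : marked_ball n x -> marked_ball n y -> f x = f y -> x = y.
Proof. by have [[_ inj_f _] _ _] := ison => xn yn; apply: inj_f; apply/mem_set. Qed.

End Transfer.

(** [Q] survives every isomorphism of sufficiently large balls. *)
Definition locally M (Q : forall N, (V M -> V N) -> Prop) :=
  exists m, forall n N (f : V M -> V N), (m <= n)%N -> iso_on n f -> Q N f.

Lemma locallyS M (Q Q' : forall N, (V M -> V N) -> Prop) :
  (forall N f, Q N f -> Q' N f) -> locally Q -> locally Q'.
Proof. by move=> QQ' [m Hm]; exists m => n N f mn /(Hm _ _ _ mn)/QQ'. Qed.

Lemma locallyI M (Q Q' : forall N, (V M -> V N) -> Prop) :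
  locally Q -> locally Q' -> locally (fun N f => Q N f /\ Q' N f).
Proof.
move=> [m Hm] [m' Hm']; exists (maxn m m') => n N f; rewrite geq_max.
by move=> /andP[mn m'n] fn; split; [exact: Hm fn|exact: Hm' fn].
Qed.

Lemma locallyT M (Q : forall N, (V M -> V N) -> Prop) :
  (forall N f, Q N f) -> locally Q.
Proof. by move=> HQ; exists 0%N => n N f _ _; exact: HQ. Qed.

Lemma locally_all M (T : eqType) (s : seq T) (Q : T -> forall N, (V M -> V N) -> Prop) :
  (forall t, t \in s -> locally (Q t)) ->
  locally (fun N f => forall t, t \in s -> Q t N f).
Proof.
elim: s => [|t s IHs] Hs; first exact: locallyT.
have := locallyI (Hs t (mem_head _ _)) (IHs (fun u us => Hs u (mem_behead (s:=t::s) us))).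
by apply: locallyS => N f [Ht Hss] u; rewrite inE => /orP[/eqP ->|/Hss].
Qed.

Lemma locally_mark M i :
  locally (fun N (f : V M -> V N) => f (tnth (marks M) i) = tnth (marks N) i).
Proof. by exists 0%N => n N f _ /iso_on_mark. Qed.

Lemma locally_adj M (x y : V M) :
  e x y -> locally (fun N (f : V M -> V N) => e (f x) (f y)).
Proof.
move=> xy; have [m Hm] := ball_list [:: x; y].
exists m => n N f mn [_ -> //]; apply: (ball_mono mn (Hm _ _));
  by rewrite !inE eqxx ?orbT.
Qed.

(** The image of a certificate lying strictly inside the ball is a certificate. *)
Lemma locally_fin_side M (v w : V M) : fin_side v w ->
  locally (fun N (f : V M -> V N) => fin_side (f v) (f w)).
Proof.
move=> [vw [S [vS wS clS]]]; have [m Hm] := ball_list (w :: S).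
have HS u : u \in S -> marked_ball m u by move=> uS; apply: Hm; rewrite inE uS orbT.
apply: locallyS (locallyI (locally_adj vw) (_ : locally (fun N (f : V M -> V N) =>
  exists S0 : seq (V N), [/\ f v \in S0, f w \notin S0 & forall u u', u \in S0 ->
    e u u' -> u' \in S0 \/ u = f v /\ u' = f w]))) => [N f [fvw fS] //|].
exists m.+1 => n N f mn fn; exists (map f S); split; first exact: map_f.
  apply: contra wS => /mapP[a aS /(iso_on_inj fn) ->] //.
    by apply: (ball_mono (ltnW mn) (Hm _ _)); rewrite mem_head.
  exact: ball_mono (ltnW mn) (HS _ aS).
move=> _ u' /mapP[a aS ->] au'.
have [b ab <-] := iso_on_lift fn mn (HS _ aS) au'.
by have [bS|[-> ->]] := clS _ _ aS ab; [left; exact: map_f|right].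
Qed.

Lemma locally_path M (R : forall G : graph D, rel (vertex G)) (x : V M) p :
  (forall y z : V M, R _ y z -> locally (fun N (f : V M -> V N) => R _ (f y) (f z))) ->
  path (@R _) x p ->
  locally (fun N (f : V M -> V N) => path (@R _) (f x) (map f p)).
Proof.
move=> HR; elim: p x => [|y p IHp] x /=; first by move=> _; exact: locallyT.
move=> /andP[xy yp]; apply: locallyS (locallyI (HR _ _ xy) (IHp _ yp)).
by move=> N f [-> ->].
Qed.

(** These are the open sets of the local topology, pulled back to marked graphs. *)
Definition local_property (P : marked D k -> Prop) :=
  forall M, P M -> locally (fun N (_ : V M -> V N) => P N).

Lemma isomorphic_on M N n : isomorphic M N -> ball_isomorphic n M N.
Proof.
move=> [f [bijf fadj fm]]; exists f; split=> //; have [g fK gK] := bijf.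
have fball m x : marked_ball m x -> marked_ball m (f x).
  elim: m x => [|m IHm] x.
    by move=> /ball0[i ->]; apply/ball0; exists i; rewrite -fm tnth_map.
  move=> /ballS[/IHm xm|[y /IHm ym yx]]; apply/ballS; [by left|right].
  by exists (f y) => //; rewrite fadj.
have gball m x : marked_ball m x -> marked_ball m (g x).
  elim: m x => [|m IHm] x.
    by move=> /ball0[i ->]; apply/ball0; exists i; rewrite -fm tnth_map fK.
  move=> /ballS[/IHm xm|[y /IHm ym yx]]; apply/ballS; [by left|right].
  by exists (g y) => //; rewrite -fadj !gK.
split=> [x /fball //|x y _ _ /(can_inj fK) //|y yn]; exists (g y) => //.
exact: gball.
Qed.

Lemma local_isomorphic P M N : local_property P -> isomorphic M N -> P M -> P N.
Proof.
move=> lP MN /lP[m Hm]; have [f fn] := isomorphic_on m MN.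
exact: (Hm m N f (leqnn m) fn).
Qed.

Definition class_with (P : marked D k -> Prop) : set (iso_space D k) :=
  [set c | P (repr (c : iso_class D k))].

(** A local property is a union of cylinders. *)
Lemma local_measurable P : local_property P -> measurable (class_with P).
Proof.
move=> lP; apply: sub_sigma_algebra.
exists [set cylinder cn | cn in [set cn | cylinder cn `<=` class_with P]].
  by move=> _ [cn _ <-]; exact: finI_from1.
rewrite predeqE => c; split=> [[_ [cn sub <-] ccn]|Pc]; first exact: sub.
have [m Hm] := lP _ Pc.
exists (cylinder (c, m)).
  exists (c, m) => //= c' [f cc']; exact: (Hm m _ f (leqnn m) cc').
exact/isomorphic_on/isomorphic_refl.
Qed.

Lemma local_class P (G : graph D) (t : k.-tuple (vertex G)) : local_property P ->
  class_with P (class_of t) <-> P (Marked t).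
Proof.
move=> lP.
have /eqmodP/asboolP iso : (repr (class_of t : iso_class D k) =
    Marked t %[mod iso_class D k])%qT by rewrite reprK.
split; first exact: local_isomorphic iso.
by apply: local_isomorphic => //; exact: isomorphic_sym.
Qed.

End Locality.

(** * Lower integrals, mass transport and rare events *)
Section LowerIntegral.
Import HBNNSimple.
Variables (R : realType) (disp : measure_display).
Variables (Omega : measurableType disp) (P : probability Omega R).
Local Open Scope ereal_scope.
Implicit Types (f g : Omega -> \bar R) (E : set Omega).

(** The integral of a nonnegative function is defined as a supremum over the
    simple functions below it, so it is monotone without measurability. This
    spares the measurability of the sums over vertices in the mass transport
    principle. *)
Lemma le_lower_integral f g : (forall w, 0 <= f w) -> (forall w, f w <= g w) ->
  \int[P]_w f w <= \int[P]_w g w.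
Proof.
move=> f0 fg; rewrite !ge0_integralTE //; last by move=> w; exact: le_trans (fg w).
apply: ereal_sup_le => _ [h hf <-]; exists h => // w; exact: le_trans (fg w).
Qed.

Lemma lower_integral_ge f E (l : R) : measurable E -> (0 <= l)%R ->
  (forall w, 0 <= f w) -> {ae P, forall w, E w -> l%:E <= f w} ->
  l%:E * P E <= \int[P]_w f w.
Proof.
move=> mE l0 f0 [N [mN PN0 sub]].
have mEN : measurable (E `\` N) by exact: measurableD.
have -> : P E = P (E `\` N).
  apply/eqP; rewrite eq_le; apply/andP; split; last first.
    by apply: le_measure; rewrite ?inE //; exact: subDsetl.
  rewrite -[leRHS]adde0 -PN0; apply: le_trans (measureU2 _ mEN mN).
  by apply: le_measure; rewrite ?inE //; [exact: measurableU|rewrite setUDl setDv setD0 => x; left].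
rewrite -[E `\` N]setIT -(integral_indic P measurableT mEN).
have mi : measurable_fun setT (fun w => (\1_(E `\` N) w)%:E : \bar R).
  exact/measurable_EFinP/measurable_indic.
rewrite -(ge0_integralZl_EFin P measurableT _ mi l0); last first.
  by move=> w _; rewrite lee_fin.
apply: le_lower_integral => w; first by rewrite -EFinM lee_fin; apply: mulr_ge0.
rewrite -EFinM indicE; have [|_] := boolP (w \in _); last by rewrite mulr0.
rewrite inE mulr1 => -[Ew Nw]; apply: contrapT => lf; apply: Nw; apply: sub => /=; by apply/not_implyP.
Qed.

Lemma lower_integral_le f (c : R) : (0 <= c)%R -> (forall w, 0 <= f w) ->
  {ae P, forall w, f w <= c%:E} -> \int[P]_w f w <= c%:E.
Proof.
move=> c0 f0 fc; rewrite ge0_integralTE //; apply: ge_ereal_sup => _ [h hf <-].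
rewrite -integralT_nnsfun.
apply: (@le_trans _ _ (\int[P]_w cst c%:E w)); last first.
  by rewrite integral_cst // [X in _ * X](probability_setT P) mule1.
apply: ae_ge0_le_integral => //.
- by move=> w _; rewrite lee_fin; exact: fun_ge0.
- exact/measurable_EFinP.
- by apply: filterS fc => w fc _; exact: le_trans (hf w) fc.
Qed.

End LowerIntegral.

Section Counting.
Variables (R : realType) (T : choiceType).
Local Open Scope ereal_scope.

Lemma sum_cst1 (s : seq T) : uniq s ->
  \sum_(x \in [set` s]) (1 : \bar R) = (size s)%:R%:E.
Proof.
by move=> Us; rewrite -fsbig_seq // sumEFin big_const_seq count_predT iter_addr addr0.
Qed.

Lemma esum_ge_size (s : seq T) (a : T -> \bar R) : uniq s ->
  (forall x, x \in s -> 1 <= a x) -> (size s)%:R%:E <= \esum_(x in setT) a x.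
Proof.
move=> Us a1; apply: esum_ge; exists [set` s]; first by split.
rewrite -sum_cst1 //; apply: lee_fsum => //.
Qed.

Lemma esum_le_size (s : seq T) (a : T -> \bar R) :
  (forall x, 0 <= a x <= 1) -> (forall x, a x != 0 -> x \in s) ->
  \esum_(x in setT) a x <= (size s)%:R%:E.
Proof.
move=> a01 supp.
have -> : \esum_(x in setT) a x = \esum_(x in [set` undup s]) a x.
  rewrite [RHS]esum_mkcond; apply: eq_esum => x _.
  case: ifPn => //; rewrite notin_setE /= mem_undup => xs.
  by apply: contrapT => /eqP/supp.
rewrite esum_fset //; last by move=> x _; have /andP[] := a01 x.
apply: (@le_trans _ _ (size (undup s))%:R%:E).
  rewrite -sum_cst1 ?undup_uniq //; apply: lee_fsum => // x _.
  by have /andP[] := a01 x.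
by rewrite lee_fin ler_nat size_undup.
Qed.

End Counting.

Section MassTransport.
Variables (R : realType) (D : nat) (disp : measure_display).
Variables (Omega : measurableType disp) (P : probability Omega R).
Variable T : {RV P >-> iso_space D 1}.
Hypothesis uniT : unimodular T.
Local Open Scope ereal_scope.

(** Markov's inequality applied to the mass received, when [x] sends mass 1 to
    [y] for each pair in [A]: the expected mass sent is at most [C]. *)
Lemma mass_transport_bound (A : set (iso_space D 2)) (E : set (iso_space D 1))
    (l C : nat) : measurable A -> measurable E ->
  {ae P, forall w, exists s : seq (vertex (rep_graph (T w))), (size s <= C)%N /\
    forall y, A (class_of [tuple Defs.root (T w); y]) -> y \in s} ->
  {ae P, forall w, E (T w) -> exists s : seq (vertex (rep_graph (T w))),
    [/\ uniq s, (l <= size s)%N &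
      forall x, x \in s -> A (class_of [tuple x; Defs.root (T w)])]} ->
  l%:R%:E * P (T @^-1` E) <= C%:R%:E.
Proof.
move=> mA mE sentC recl.
pose F c : \bar R := (\1_A c)%:E.
have F0 c : 0 <= F c by rewrite lee_fin.
have F1 c : F c <= 1 by rewrite /F indicE lee_fin; case: (_ \in _); rewrite ?ler01.
have sent : \int[P]_w (\esum_(y in setT) F (class_of [tuple Defs.root (T w); y])) <= C%:R%:E.
  apply: lower_integral_le => //; first by move=> w; exact: esum_ge0.
  apply: filterS sentC => w [s [sC Hs]].
  apply: (@le_trans _ _ (size s)%:R%:E); last by rewrite lee_fin ler_nat.
  apply: esum_le_size => y; first by rewrite F0 F1.
  by rewrite /F indicE; have [/set_mem/Hs //|_] := boolP (_ \in A); rewrite eqxx.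
have rec : l%:R%:E * P (T @^-1` E) <=
    \int[P]_w (\esum_(x in setT) F (class_of [tuple x; Defs.root (T w)])).
  apply: lower_integral_ge => //.
  - by rewrite -[X in measurable X]setTI; exact: measurable_funP.
  - by move=> w; exact: esum_ge0.
  apply: filterS recl => w Hw Ew; have [s [Us ls Hs]] := Hw Ew.
  apply: (@le_trans _ _ (size s)%:R%:E); first by rewrite lee_fin ler_nat.
  by apply: esum_ge_size => // x /Hs Ax; rewrite /F indicE mem_set.
apply: (le_trans rec); rewrite -(uniT _ F0); first exact: sent.
- exact/measurable_EFinP/measurable_indic.
- by rewrite (le_lt_trans sent) ?ltry.
Qed.

End MassTransport.

(** The first Borel-Cantelli lemma for a convergent series of inverse squares. *)
Lemma ae_eventually_not (R : realType) (disp : measure_display)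
    (Omega : measurableType disp) (P : probability Omega R) (E : nat -> set Omega) :
  (forall n, measurable (E n)) ->
  (forall n, ((n.+1 ^ 2)%:R%:E * P (E n) <= 1)%E) ->
  {ae P, forall w, exists N, forall n, (N <= n)%N -> ~ E n w}.
Proof.
move=> mE smallE.
have null : P (lim_sup_set E) = 0%E.
  apply: lim_sup_set_cvg0 => //.
  apply: (@le_lt_trans _ _ 2%:R%:E); last exact: ltry.
  apply: lime_le; first exact: is_cvg_nneseries.
  apply: nearW => n.
  (* [2 / x] decreases by at least the inverse square of [x] from [x] to [x + 1]. *)
  suff : (\sum_(0 <= i < n) P (E i) <= (2 - 2 / n.+1%:R)%:E)%E.
    by move/le_trans; apply; rewrite lee_fin gerBl divr_ge0.
  elim: n => [|n IHn]; first by rewrite big_geq // lee_fin; lra.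
  rewrite big_nat_recr //=.
  have PE : (P (E n) <= ((n.+1 ^ 2)%:R^-1)%:E)%E.
    have := smallE n; rewrite -[P (E n)]fineK ?fin_num_measure //.
    rewrite -EFinM !lee_fin => h.
    by rewrite -[leRHS]mul1r ler_pdivlMr ?ltr0n ?expn_gt0 // mulrC.
  apply: (le_trans (leeD IHn PE)); rewrite -EFinD lee_fin.
  rewrite natrX -[n.+2]addn1 natrD.
  have : (1 <= n.+1%:R :> R)%R by rewrite ler1n.
  move: (n.+1%:R : R) => x x1; have x0 : (0 < x)%R by lra.
  have x2 : (0 < x + 1)%R by lra.
  rewrite -subr_ge0.
  have -> : (2 - 2 / (x + 1) - (2 - 2 / x + (x ^+ 2)^-1) =
             (x - 1) / (x ^+ 2 * (x + 1)))%R.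
    apply: (@mulIf _ (x ^+ 2 * (x + 1))%R); first by rewrite mulf_neq0 ?expf_neq0 ?gt_eqF.
    rewrite mulfVK ?mulf_neq0 ?expf_neq0 ?gt_eqF //.
    have e1 : (x^-1 * x = 1)%R by rewrite mulVf ?gt_eqF.
    have e2 : ((x + 1)^-1 * (x + 1) = 1)%R by rewrite mulVf ?gt_eqF.
    rewrite invfM exprS expr1.
    have -> : ((2 - 2 * (x + 1)^-1 - (2 - 2 * x^-1 + x^-1 * x^-1)) * (x * x * (x + 1)) =
      - (2 * ((x + 1)^-1 * (x + 1)) * (x * x)) + 2 * (x^-1 * x) * (x * (x + 1))
      - (x^-1 * x) * (x^-1 * x) * (x + 1))%R by lra.
    by rewrite e1 e2; lra.
  apply: divr_ge0; [lra|apply: mulr_ge0; [exact: sqr_ge0|lra]].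
have mlim : measurable (lim_sup_set E).
  by apply: bigcapT_measurable => n; apply: bigcup_measurable => k _.
exists (lim_sup_set E); split=> // w /= nw n _.
apply: contrapT => nE; apply: nw; exists n => k nk Ek.
by apply: nE; exists k.
Qed.

(** * One-ended trees *)
Lemma size_flatten_le (T : Type) (S : eqType) (f : S -> seq T) (s : seq S) b :
  (forall u, u \in s -> (size (f u) <= b)%N) ->
  (size (flatten [seq f u | u <- s]) <= size s * b)%N.
Proof.
elim: s => //= u s IHs Hs; rewrite size_cat mulSn leq_add ?Hs ?mem_head //.
by apply: IHs => v vs; apply: Hs; rewrite inE vs orbT.
Qed.

Definition finb (D : nat) (G : graph D) : rel (vertex G) :=
  fun v w => `[< fin_side v w >].
Arguments finb {D} G.

Section OneEnd.
Variables (D : nat) (G : graph D).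
Local Notation V := (vertex G).
Local Notation e := (@adj D G).
Hypothesis treeG : is_tree G.
Variable r : nat -> V.
Hypothesis endr : ends_among r r.
Implicit Types (x y z u v w : V).

Let rayr : is_ray r. Proof. by case: endr. Qed.

Definition par v : V := projT1 (cid (toward_ex treeG v rayr)).

Lemma toward_par v : toward r v (par v).
Proof. by rewrite /par; case: cid. Qed.

(** In a one-ended tree the finite side of an edge is the one away from the end,
    so the parent function of the end is a local notion. *)
Lemma finb_par v w : finb G v w = (par v == w).
Proof.
apply/asboolP/eqP => [/(fin_side_toward treeG rayr)|<-].
  exact/toward_uniq/toward_par.
exact: (toward_fin_side treeG endr (toward_par v) (toward_par v)).
Qed.

Lemma par_adj v : e v (par v). Proof. by case: (toward_par v). Qed.

Lemma par_neq u v : par u = v -> par v != u.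
Proof.
move=> <-; apply/eqP => uu; have := toward_par (par u); rewrite uu => tu.
exact: (toward_asym treeG tu (toward_par u)).
Qed.

Lemma adj_par x y : e x y -> par x = y \/ par y = x.
Proof.
move=> xy; have [t|t] := toward_total treeG rayr xy; [left|right];
  exact: (toward_uniq treeG (toward_par _) t).
Qed.

Lemma finb_path x p : path (finb G) x p -> last x p = iter (size p) par x.
Proof.
elim: p x => //= y p IHp x /andP[]; rewrite finb_par => /eqP <- /IHp ->.
by rewrite -iterSr.
Qed.

Lemma path_finb x j : exists p,
  [/\ path (finb G) x p, last x p = iter j par x & size p = j].
Proof.
elim: j x => [|j IHj] x; first by exists [::].
have [p [xp px pj]] := IHj (par x); exists (par x :: p).
by rewrite /= finb_par eqxx xp px pj -iterSr.
Qed.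

Definition kids z := [seq u <- nbrs z | u != par z].

Lemma size_kids z : (size (kids z) <= D.-1)%N.
Proof.
have -> : kids z = rem (par z) (nbrs z) by rewrite rem_filter ?nbrs_uniq.
rewrite size_rem ?mem_nbrs ?par_adj //.
have := size_nbrs z; case: (size _) => //= n; case: D => //.
Qed.

Fixpoint descendants k z :=
  if k is k'.+1 then flatten [seq kids u | u <- descendants k' z] else [:: z].

Lemma size_descendants k z : (size (descendants k z) <= D.-1 ^ k)%N.
Proof.
elim: k => //= k IHk; rewrite expnSr.
apply: leq_trans (size_flatten_le (b := D.-1) _) _; last by rewrite leq_mul2r IHk orbT.
by move=> u _; exact: size_kids.
Qed.

Lemma mem_descendants k y : y \in descendants k (iter k par y).
Proof.
elim: k y => [|k IHk] y; first by rewrite /= inE.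
apply/flattenP; exists (kids (par y)).
  by apply: map_f; rewrite iterSr.
by rewrite mem_filter mem_nbrs adjC par_adj eq_sym par_neq.
Qed.

(** A parent has both a child and a parent of its own. *)
Lemma one_end_degree : (1 < D)%N.
Proof.
have := size_nbrs (par (r 0%N)).
have : (size [:: r 0%N; par (par (r 0%N))] <= size (nbrs (par (r 0%N))))%N.
  apply: uniq_leq_size; first by rewrite /= inE eq_sym par_neq.
  by move=> x; rewrite !inE mem_nbrs => /orP[/eqP ->|/eqP ->]; rewrite ?par_adj // adjC par_adj.
exact: leq_trans.
Qed.

(** Each step of a walk goes to the parent of the current vertex or comes from a
    child of the next one, and either case lengthens at most one of the two
    ascending lines that meet. *)
Lemma ball_confluent x y n : graph_ball x n y ->
  exists j k, (j + k <= n)%N /\ iter j par x = iter k par y.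
Proof.
move=> [p [xp <- pn]].
suff [j [k [jk H]]] : exists j k, (j + k <= size p)%N /\
    iter j par x = iter k par (last x p).
  by exists j, k; rewrite (leq_trans jk).
elim/last_ind: p xp {pn} => [|p z IHp]; first by exists 0%N, 0%N.
rewrite rcons_path last_rcons size_rcons => /andP[/IHp[j [k [jk Hjk]]] pz].
have [pz1|pz1] := adj_par pz; last first.
  by exists j, k.+1; rewrite iterSr pz1 addnS ltnS.
case: k jk Hjk => [|k] jk Hjk; [exists j.+1, 0%N|exists j, k].
  by rewrite addn0 /= Hjk /= pz1 ltnS -[j]addn0.
by rewrite -pz1 -iterSr; split=> //; lia.
Qed.

(** This list contains the vertices [y] whose line meets the line of [x], within
    total length [n], no further from [y] than from [x]: their descent is at most
    [n / 2]. *)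
Definition half_confluents x n := flatten [seq descendants jk.2 (iter jk.1 par x) |
  jk <- [seq (j, k) | j <- iota 0 n.+1, k <- iota 0 (n./2).+1]].

Lemma mem_half_confluents x y n j k : (j + k <= n)%N -> (k <= j)%N ->
  iter j par x = iter k par y -> y \in half_confluents x n.
Proof.
move=> jkn kj H; apply/flattenP; exists (descendants k (iter j par x)).
  apply/mapP; exists (j, k) => //; apply/allpairsP; exists (j, k).
  by rewrite !mem_iota /=; split=> //; lia.
by rewrite H mem_descendants.
Qed.

Lemma size_half_confluents x n :
  (size (half_confluents x n) <= n.+1 ^ 2 * D.-1 ^ n./2)%N.
Proof.
apply: leq_trans (size_flatten_le (b := D.-1 ^ n./2) _) _.
  move=> [j k] /allpairsP[[j' k'] [_ + [-> ->]]]; rewrite mem_iota /= => kn.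
  apply: (leq_trans (size_descendants _ _)).
  by rewrite leq_pexp2l //; have := one_end_degree; lia.
rewrite leq_mul2r; apply/orP; right.
by rewrite size_allpairs !size_iota expnS expn1 leq_mul2l; lia.
Qed.

End OneEnd.

(** The lines of [x] and [y] meet strictly closer to [y] than to [x]. Seen from [x]
    such [y] are few; seen from [y] such [x] are the whole ball except its few half
    confluents. *)
Definition confluent_at (D n : nat) (G : graph D) (x y : vertex G) :=
  exists p q, [/\ path (finb G) x p, path (finb G) y q, last x p = last y q,
    (size p + size q <= n)%N & (size q < size p)%N].

Definition confluent_property D n (M : marked D 2) :=
  confluent_at n (tnth (marks M) ord0) (tnth (marks M) (lift ord0 ord0)).

(** The ball of radius [n] has at least [m] vertices. *)
Definition crowded D n m (M : marked D 1) :=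
  exists s : seq (vertex (graph_of M)), [/\ uniq s, (m <= size s)%N &
    forall x, x \in s -> graph_ball (thead (marks M)) n x].

Lemma locally_finb D k (M : marked D k.+1) (v w : vertex (graph_of M)) :
  finb _ v w -> locally (fun N (f : vertex (graph_of M) -> vertex (graph_of N)) =>
    finb _ (f v) (f w)).
Proof.
by move=> /asboolP/locally_fin_side; apply: locallyS => N f ?; exact/asboolP.
Qed.

Lemma local_confluent D n : local_property (@confluent_property D n).
Proof.
move=> M [p [q [xp yq pq pqn qp]]].
have := locallyI (locallyI (locally_mark M ord0) (locally_mark M (lift ord0 ord0)))
  (locallyI (locally_path (R := @finb D) (@locally_finb _ _ M) xp)
            (locally_path (R := @finb D) (@locally_finb _ _ M) yq)).
apply: locallyS => N f [[fx fy] [fp fq]].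
by exists (map f p), (map f q); rewrite -fx -fy !last_map pq !size_map.
Qed.

Lemma locally_ball D k (M : marked D k.+1) x n y : graph_ball x n y ->
  locally (fun N (f : vertex (graph_of M) -> vertex (graph_of N)) =>
    graph_ball (f x) n (f y)).
Proof.
move=> [p [xp <- pn]].
apply: locallyS (locally_path (R := @adj D) (@locally_adj _ _ M) xp) => N f fp.
by exists (map f p); rewrite last_map size_map.
Qed.

Lemma locally_uniq D k (M : marked D k.+1) (s : seq (vertex (graph_of M))) : uniq s ->
  locally (fun N (f : vertex (graph_of M) -> vertex (graph_of N)) =>
    uniq (map f s)).
Proof.
move=> Us; have [m Hm] := ball_list s.
exists m => n N f mn fn; rewrite map_inj_in_uniq // => x y xs ys.
by apply: (iso_on_inj fn); apply: ball_mono mn _; apply: Hm.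
Qed.

Lemma local_crowded D n m : local_property (@crowded D n m).
Proof.
move=> M [s [Us ms Hs]].
have := locallyI (locally_mark M ord0)
  (locallyI (locally_uniq Us) (locally_all (fun x xs => locally_ball (Hs x xs)))).
apply: locallyS => N f [fo [Ufs fs]]; exists (map f s); rewrite size_map.
split=> // _ /mapP[x xs ->]; rewrite /thead -fo; exact: fs.
Qed.

Section OneEndCounting.
Variables (D : nat) (G : graph D).
Hypotheses (treeG : is_tree G) (oneG : (ends G #= `I_1)%card).
Implicit Types x y o : vertex G.

Definition confluent_bound (n : nat) := (n.+1 ^ 2 * D.-1 ^ n./2)%N.

Lemma confluent_from o n : exists s : seq (vertex G),
  (size s <= confluent_bound n)%N /\ forall y, confluent_at n o y -> y \in s.
Proof.
have [r endr] := one_end_ray oneG.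
exists (half_confluents treeG endr o n); split; first exact: size_half_confluents.
move=> y [p [q [/(finb_path treeG endr) op /(finb_path treeG endr) yq pq pqn qp]]].
by apply: (mem_half_confluents pqn (ltnW qp)); rewrite -op -yq.
Qed.

(** The vertices of a ball that are not half confluents of its centre have
    the centre as a confluent. *)
Lemma confluent_to o n m (s : seq (vertex G)) : uniq s ->
  (m + confluent_bound n <= size s)%N ->
  (forall x, x \in s -> graph_ball o n x) ->
  exists s' : seq (vertex G), [/\ uniq s', (m <= size s')%N &
    forall x, x \in s' -> confluent_at n x o].
Proof.
have [r endr] := one_end_ray oneG => Us ms so.
pose L := half_confluents treeG endr o n.
exists [seq x <- s | x \notin L]; split; first exact: filter_uniq.
  have : (size [seq x <- s | x \in L] <= size L)%N.
    apply: uniq_leq_size; first exact: filter_uniq.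
    by move=> x; rewrite mem_filter => /andP[].
  move=> /leq_trans/(_ (size_half_confluents treeG endr o n)).
  rewrite -/(confluent_bound n); move: ms; move: (confluent_bound n) => C ms.
  have := count_predC [in L] s; rewrite !size_filter.
  rewrite (_ : count (predC _) s = count (fun x => x \notin L) s) //.
  by move=> cs aC; rewrite -(leq_add2r C) (leq_trans ms) // -cs addnC leq_add2l.
move=> x; rewrite mem_filter => /andP[xL /so/(ball_confluent treeG endr)].
move=> [j [k [jkn jk]]].
have [kj|jk'] := leqP k j; first by rewrite (mem_half_confluents jkn kj jk) in xL.
have [p [xp px pk]] := path_finb treeG endr x k.
have [q [oq qo qj]] := path_finb treeG endr o j.
by exists p, q; rewrite px qo pk qj jk addnC.
Qed.

End OneEndCounting.

Section OneEndRandom.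
Variables (R : realType) (D : nat) (disp : measure_display).
Variables (Omega : measurableType disp) (P : probability Omega R).
Variable T : {RV P >-> iso_space D 1}.

Lemma class_confluent n (G : graph D) (x y : vertex G) :
  class_with (@confluent_property D n) (class_of [tuple x; y]) <-> confluent_at n x y.
Proof. exact: (local_class _ (@local_confluent D n)). Qed.

(** Large balls would receive much more mass than any vertex sends. The factor
    [n.+1 ^ 2] makes the exceptional probabilities summable; one further
    [confluent_bound] pays for the half confluents. *)
Lemma one_ended_uncrowded : unimodular_tree T ->
  {ae P, forall w, one_ended (T w)} ->
  {ae P, forall w, exists N, forall n, (N <= n)%N ->
    ~ crowded n ((n.+1 ^ 2).+1 * confluent_bound D n) (repr (T w : iso_class D 1))}.
Proof.
move=> [uniT treeT] oneT.
have {treeT oneT} TT : {ae P, forall w, is_tree (rep_graph (T w)) /\ one_ended (T w)}.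
  by apply: filterS2 treeT oneT.
have [D1|D1] := leqP D 1.
  apply: filterS TT => w [tw ow]; have [r endr] := one_end_ray ow.
  by have := one_end_degree tw endr; rewrite ltnNge D1.
pose E n := class_with (@crowded D n ((n.+1 ^ 2).+1 * confluent_bound D n)).
have mE n : measurable (E n) by apply: local_measurable; exact: local_crowded.
apply: (@ae_eventually_not _ _ _ P (fun n => T @^-1` E n)) => n.
  by rewrite -[X in measurable X]setTI; exact: measurable_funP.
have C0 : (0 < confluent_bound D n)%N.
  have D0 : (0 < D.-1)%N by rewrite -subn1 subn_gt0.
  by rewrite muln_gt0 !expn_gt0 D0.
have : ((n.+1 ^ 2 * confluent_bound D n)%:R%:E * P (T @^-1` E n) <=
        (confluent_bound D n)%:R%:E)%E.
  apply: (mass_transport_bound uniT (A := class_with (@confluent_property D n))) => //.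
  - by apply: local_measurable; exact: local_confluent.
  - apply: filterS TT => w [tw ow].
    have [s [sC Hs]] := confluent_from tw ow (Defs.root (T w)) n.
    by exists s; split=> // y /class_confluent/Hs.
  - apply: filterS TT => w [tw ow] [s [Us ms Hs]].
    rewrite mulSn addnC in ms.
    have [s' [Us' ms' Hs']] := confluent_to tw ow Us ms Hs.
    by exists s'; split=> // x /Hs'/class_confluent.
rewrite natrM EFinM muleAC => h.
have Cp : (0 < (confluent_bound D n)%:R :> R)%R by rewrite ltr0n.
rewrite -(@lee_pmul2r _ (confluent_bound D n)%:R%:E) ?mul1e //.
Qed.

End OneEndRandom.

(** * Two-ended trees *)
(** Edges with at least one finite side. In a two-ended tree the other edges form
    the trunk, and deleting them leaves the finite bushes hanging off it. *)
Definition finE (D : nat) (G : graph D) : rel (vertex G) :=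
  fun v w => finb G v w || finb G w v.
Arguments finE {D} G.

Definition bush (D : nat) (G : graph D) (z : vertex G) : set (vertex G) :=
  [set y | exists2 p, path (finE G) z p & last z p = y].

(** The number of steps of a walk along edges with two infinite sides. *)
Fixpoint cost (D : nat) (G : graph D) (x : vertex G) (p : seq (vertex G)) : nat :=
  if p is y :: p' then (~~ finE G x y + cost y p')%N else 0%N.

Definition big_bush (D k : nat) (G : graph D) (y : vertex G) :=
  exists s : seq (vertex G), [/\ uniq s, (k < size s)%N &
    forall t, t \in s -> bush y t].

(** Requiring few infinite edges, rather than a given number of trunk steps, keeps
    the condition open in the local topology; every walk of length at most [n]
    qualifies. *)
Definition cheap_walk (D n : nat) (G : graph D) (x y : vertex G) :=
  exists p, [/\ path (@adj D G) y p, last y p = x & (cost y p <= n)%N].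

Section Bushes.
Variables (D : nat) (G : graph D).
Local Notation V := (vertex G).
Local Notation e := (@adj D G).
Implicit Types (x y z u v w t : V) (p q : seq V).

Lemma finE_sym : symmetric (finE G). Proof. by move=> x y; rewrite /finE orbC. Qed.

Lemma finb_adj x y : finb G x y -> e x y. Proof. by move=> /asboolP[]. Qed.

Lemma cost_size x p : (cost x p <= size p)%N.
Proof. by elim: p x => //= y p IHp x; rewrite -add1n leq_add // leq_b1. Qed.

Lemma bush_refl z : bush z z. Proof. by exists [::]. Qed.

Lemma bush_step z y y' : bush z y -> finE G y y' -> bush z y'.
Proof.
move=> [p zp <-] yy'; exists (rcons p y'); last by rewrite last_rcons.
by rewrite rcons_path zp.
Qed.

Lemma bush_sym z y : bush z y -> bush y z.
Proof.
by move=> [p /(sym_path_rev finE_sym)[q [yq qz _]] <-]; exists q.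
Qed.

Lemma bush_trans z y x : bush z y -> bush y x -> bush z x.
Proof.
move=> [p zp <-] [q yq <-]; exists (p ++ q); last by rewrite last_cat.
by rewrite cat_path zp.
Qed.

Lemma bush_ind z (Q : V -> Prop) : Q z ->
  (forall y y', Q y -> finE G y y' -> Q y') -> bush z `<=` Q.
Proof.
move=> Qz Qstep y [p zp <-]; elim/last_ind: p zp => // p y' IHp.
rewrite rcons_path last_rcons => /andP[/IHp]; exact: Qstep.
Qed.

Hypothesis treeG : is_tree G.
Variables r s : nat -> V.
Hypotheses (endrs : ends_among r s) (nrs : ~ same_end r s).

Let rayr : is_ray r. Proof. by case: endrs. Qed.
Let rays : is_ray s. Proof. by case: endrs. Qed.

Let parr v : V := projT1 (cid (toward_ex treeG v rayr)).
Let pars v : V := projT1 (cid (toward_ex treeG v rays)).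

Let toward_parr v : toward r v (parr v). Proof. by rewrite /parr; case: cid. Qed.
Let toward_pars v : toward s v (pars v). Proof. by rewrite /pars; case: cid. Qed.

Let parrE v w : toward r v w <-> parr v = w.
Proof. by split=> [|<- //]; exact/toward_uniq. Qed.
Let parsE v w : toward s v w <-> pars v = w.
Proof. by split=> [|<- //]; exact/toward_uniq. Qed.

Definition trunk v := parr v != pars v.

Lemma finb_pars v w : finb G v w <-> parr v = w /\ pars v = w.
Proof.
split=> [/asboolP f|[/parrE tr /parsE ts]].
  by split; [apply/parrE|apply/parsE]; exact: fin_side_toward.
exact/asboolP/(toward_fin_side treeG endrs).
Qed.

(** An edge is finite when both ends of the tree lie on the same side of it; otherwise it
    belongs to the trunk. *)
Lemma edge_cases x y : e x y -> [\/ finE G x y, parr x = y /\ pars y = x |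
  pars x = y /\ parr y = x].
Proof.
move=> xy; have [/parrE tr|/parrE tr] := toward_total treeG rayr xy;
  have [/parsE ts|/parsE ts] := toward_total treeG rays xy.
- by constructor 1; apply/orP; left; apply/finb_pars.
- by constructor 2.
- by constructor 3.
- by constructor 1; apply/orP; right; apply/finb_pars.
Qed.

Lemma parr_neq u v : parr u = v -> parr v != u.
Proof.
move=> /parrE uv; apply/eqP => /parrE vu; exact: (toward_asym treeG vu uv).
Qed.
Lemma pars_neq u v : pars u = v -> pars v != u.
Proof.
move=> /parsE uv; apply/eqP => /parsE vu; exact: (toward_asym treeG vu uv).
Qed.

Lemma infinite_edge_trunk x y : parr x = y -> pars y = x -> trunk x /\ trunk y.
Proof.
move=> xy yx; rewrite /trunk xy yx; split; first by rewrite eq_sym pars_neq.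
exact: parr_neq.
Qed.

(** On the trunk the two directions are inverse to each other. *)
Lemma trunk_parr z : trunk z -> pars (parr z) = z.
Proof.
move=> tz; have [zy _] := toward_parr z.
have [/parsE ts|/parsE //] := toward_total treeG rays zy.
by move: tz; rewrite /trunk ts eqxx.
Qed.

Lemma trunk_pars z : trunk z -> parr (pars z) = z.
Proof.
move=> tz; have [zy _] := toward_pars z.
have [/parrE ts|/parrE //] := toward_total treeG rayr zy.
by move: tz; rewrite /trunk ts eqxx.
Qed.

Lemma trunk_iter_parr i z : trunk z -> trunk (iter i parr z).
Proof.
move=> tz; elim: i => //= i IHi.
by have [] := infinite_edge_trunk (erefl _) (trunk_parr IHi).
Qed.

Lemma trunk_iter_pars i z : trunk z -> trunk (iter i pars z).
Proof.
move=> tz; elim: i => //= i IHi.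
by have [] := infinite_edge_trunk (trunk_pars IHi) (erefl _).
Qed.

Lemma trunk_ex : exists z, trunk z.
Proof.
have [v [w [/parrE vw /parsE wv]]] := separating_edge treeG rayr rays nrs.
by exists v; have [] := infinite_edge_trunk vw wv.
Qed.

Definition leads_to z y := exists j, iter j parr y = z /\
  forall i, (i < j)%N -> ~~ trunk (iter i parr y).

(** Off the trunk both rays give the same direction, and every finite edge is one
    step in this direction, one way or the other. *)
Lemma bush_leads_to z : trunk z -> bush z `<=` leads_to z.
Proof.
move=> tz; apply: bush_ind; first by exists 0%N.
move=> y y' [j [jz Hj]] /orP[/finb_pars[y1 y2]|/finb_pars[y1 y2]].
  case: j jz Hj => [|j] /= jz Hj; first by rewrite -jz /trunk y1 y2 eqxx in tz.
  exists j; split; first by rewrite -y1 -iterSr.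
  by move=> i ij; rewrite -y1 -iterSr; exact: Hj.
exists j.+1; rewrite iterSr y1; split=> // -[|i] ij /=.
  by rewrite /trunk y1 y2 eqxx.
by have := Hj i ij; rewrite -y1 -iterSr.
Qed.

(** So a bush contains at most one trunk vertex, and a walk can pass from one bush
    to another only through their trunk vertices. *)
Lemma bush_trunk z y : trunk z -> trunk y -> bush z y -> y = z.
Proof.
move=> tz ty /(bush_leads_to tz)[[|j] [jz Hj]] //.
by have := Hj 0%N isT; rewrite /= ty.
Qed.

(** The bush of [z] is made of [z] and of the finite sides attached to it. *)
Lemma bush_listed z : trunk z -> listed (bush z).
Proof.
move=> tz.
have : forall u, u \in [seq u <- nbrs z | finb G u z] -> listed (side u z).
  by move=> u; rewrite mem_filter => /andP[/asboolP/(fin_sideP treeG)[]].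
move=> /listed_bigcup[l Hl]; exists (z :: l) => y /(bush_leads_to tz)[j [jz Hj]].
case: j jz Hj => [<- _|j jz Hj]; first exact: mem_head.
rewrite inE Hl ?orbT //; exists (iter j parr y).
  have nt := Hj j (ltnSn j); have zj : parr (iter j parr y) = z by [].
  have fz : finb G (iter j parr y) z.
    by apply/finb_pars; split=> //; move: nt; rewrite /trunk negbK zj => /eqP.
  by rewrite mem_filter fz mem_nbrs adjC finb_adj.
elim: j y jz Hj => [|j IHj] y jz Hj.
  by apply/side_refl/adj_neq; rewrite -jz; case: (toward_parr y).
have sy := IHj (parr y); rewrite -!iterSr in sy.
have {}sy : side (iter j.+1 parr y) z (parr y).
  by apply: sy => // i ij; rewrite -iterSr; exact: (Hj i.+1).
have [uz _] := toward_parr (iter j.+1 parr y); rewrite -[parr _]/(iter j.+2 parr y) jz in uz.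
have yp : e (parr y) y by rewrite adjC; case: (toward_parr y).
have [//|[_ yz]] := side_step treeG uz sy yp.
by have := Hj 0%N isT; rewrite /= yz tz.
Qed.

(** Along a walk from a trunk vertex, a finite edge stays in the current bush and
    an infinite edge arrives at a trunk vertex. *)
Lemma bush_cover y : exists2 z, trunk z & bush z y.
Proof.
have [z0 t0] := trunk_ex; have [p zp <-] := adj_conn z0 y.
elim/last_ind: p zp => [|p y' IHp]; first by exists z0 => //; exact: bush_refl.
rewrite rcons_path last_rcons => /andP[/IHp[z tz bz] /edge_cases[f|[a b]|[a b]]].
- by exists z => //; exact: bush_step f.
- by exists y'; [have [] := infinite_edge_trunk a b|exact: bush_refl].
- by exists y'; [have [] := infinite_edge_trunk b a|exact: bush_refl].
Qed.

Lemma bush_finite y : exists k, ~ big_bush k y.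
Proof.
have [z tz zy] := bush_cover y; have [l Hl] := bush_listed tz.
exists (size l) => -[t [Ut lt Ht]]; move: lt; rewrite ltnNge => /negP; apply.
apply: uniq_leq_size Ut _ => x /Ht yx; apply: Hl; exact: bush_trans yx.
Qed.

(** The [2 n + 1] trunk vertices at distance at most [n] from [z], with [z] listed
    twice. *)
Definition trunk_ball z n :=
  [seq iter i parr z | i <- iota 0 n.+1] ++ [seq iter i pars z | i <- iota 0 n.+1].

Lemma mem_trunk_ball z n y : y \in trunk_ball z n <->
  exists2 i, (i <= n)%N & y = iter i parr z \/ y = iter i pars z.
Proof.
rewrite mem_cat; split=> [/orP[]/mapP[i]|[i ni [->|->]]].
- by rewrite mem_iota ltnS => /andP[_ ni] ->; exists i => //; left.
- by rewrite mem_iota ltnS => /andP[_ ni] ->; exists i => //; right.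
- by apply/orP; left; apply/mapP; exists i; rewrite ?mem_iota ?ltnS.
- by apply/orP; right; apply/mapP; exists i; rewrite ?mem_iota ?ltnS.
Qed.

Lemma trunk_ball_step z0 n z : trunk z0 -> z \in trunk_ball z0 n ->
  parr z \in trunk_ball z0 n.+1 /\ pars z \in trunk_ball z0 n.+1.
Proof.
move=> t0 /mem_trunk_ball[i ni [->|->]]; split; apply/mem_trunk_ball.
- by exists i.+1 => //; left.
- case: i ni => [|i] ni; first by exists 1%N => //; right.
  exists i; [lia|left]; rewrite -[in RHS](trunk_parr (trunk_iter_parr i t0)) //.
- case: i ni => [|i] ni; first by exists 1%N => //; left.
  exists i; [lia|right]; rewrite -[in RHS](trunk_pars (trunk_iter_pars i t0)) //.
- by exists i.+1 => //; right.
Qed.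

(** Each infinite edge moves the current trunk vertex by one step along the trunk. *)
Lemma cheap_walk_bush z0 o y n : trunk z0 -> bush z0 o -> cheap_walk n o y ->
  exists z, [/\ trunk z, bush z y & z \in trunk_ball z0 n].
Proof.
move=> t0 z0o [p [yp po pn]].
suff [z [tz zy zp]] : exists z, [/\ trunk z, bush z y & z \in trunk_ball z0 (cost y p)].
  exists z; split=> //; have [i ip H] := (mem_trunk_ball _ _ _).1 zp.
  by apply/mem_trunk_ball; exists i => //; exact: leq_trans pn.
elim: p y yp po {pn} => [|y' p IHp] y /=.
  by move=> _ ->; exists z0; split=> //; apply/mem_trunk_ball; exists 0%N => //; left.
move=> /andP[yy' y'p] po; have [z [tz zy' zp]] := IHp _ y'p po.
have [f|nf] := boolP (finE G y y').
  by exists z; split=> //; apply: bush_step zy' _; rewrite finE_sym.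
rewrite adjC in yy'; rewrite add1n.
have [f|[a b]|[a b]] := edge_cases yy'; first by rewrite finE_sym f in nf.
- have [ty' ty] := infinite_edge_trunk a b.
  rewrite (bush_trunk tz ty' zy') in a.
  exists y; split=> //; first exact: bush_refl.
  by rewrite -a; have [] := trunk_ball_step t0 zp.
- have [ty ty'] := infinite_edge_trunk b a.
  rewrite (bush_trunk tz ty' zy') in a.
  exists y; split=> //; first exact: bush_refl.
  by rewrite -a; have [] := trunk_ball_step t0 zp.
Qed.

(** At most [2 n + 2] bushes are reachable, and only those with at most [k] vertices
    count. *)
Lemma cheap_walks_listed k n o : exists l : seq V,
  (size l <= 2 * n.+1 * k)%N /\
  forall y, cheap_walk n o y -> ~ big_bush k y -> y \in l.
Proof.
have [z0 t0 z0o] := bush_cover o.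
pose members z : seq V := if pselect (trunk z) is left tz then
  let l := [seq t <- undup (projT1 (cid (bush_listed tz))) | `[< bush z t >]] in
  if (size l <= k)%N then l else [::] else [::].
exists (flatten [seq members z | z <- trunk_ball z0 n]); split.
  apply: leq_trans (size_flatten_le (b := k) _) _; last first.
    by rewrite size_cat !size_map !size_iota addnn -mul2n.
  by move=> z _; rewrite /members; case: pselect => //= tz; case: ifP.
move=> y /(cheap_walk_bush t0 z0o)[z [tz zy zn]] small.
apply/flattenP; exists (members z); first exact: map_f.
rewrite /members; case: pselect => // {}tz; case: cid => l Hl /=.
set l' := [seq t <- _ | _].
have Hl' t : (t \in l') = `[< bush z t >].
  rewrite mem_filter mem_undup andb_idr // => /asboolP; exact: Hl.
case: ifPn => [_|]; first by rewrite Hl'; exact/asboolP.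
rewrite -ltnNge => big; case: small; exists l'; split=> //.
  exact/filter_uniq/undup_uniq.
move=> t; rewrite Hl' => /asboolP zt; exact: bush_trans (bush_sym zy) zt.
Qed.

End Bushes.

Section BushLocality.
Variables (D k' : nat).
Local Notation V M := (vertex (graph_of M)).
Implicit Types M N : marked D k'.+1.

Lemma locally_finE M (x y : V M) : finE _ x y ->
  locally (fun N (f : V M -> V N) => finE _ (f x) (f y)).
Proof.
by move=> /orP[]/locally_finb; apply: locallyS => N f; rewrite /finE => ->; rewrite ?orbT.
Qed.

Lemma locally_cost M (x : V M) p :
  locally (fun N (f : V M -> V N) => (cost (f x) (map f p) <= cost x p)%N).
Proof.
elim: p x => [|y p IHp] x /=; first exact: locallyT.
have [f|nf] := boolP (finE _ x y).
  by apply: locallyS (locallyI (locally_finE f) (IHp y)) => N g [-> H]; rewrite leq_add2l.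
by apply: locallyS (IHp y) => N g H; rewrite leq_add // leq_b1.
Qed.

Lemma locally_bush M (y t : V M) : bush y t ->
  locally (fun N (f : V M -> V N) => bush (f y) (f t)).
Proof.
move=> [p yp <-]; apply: locallyS (locally_path (R := @finE D) (@locally_finE M) yp).
by move=> N f fp; exists (map f p); rewrite ?last_map.
Qed.

Lemma local_big_bush k i :
  local_property (fun M : marked D k'.+1 => big_bush k (tnth (marks M) i)).
Proof.
move=> M [s [Us ks Hs]].
apply: locallyS (locallyI (locally_mark M i) (locallyI (locally_uniq Us)
  (locally_all (fun t ts => locally_bush (Hs t ts))))) => N f [fo [Ufs fs]].
exists (map f s); rewrite size_map; split=> // _ /mapP[t ts ->].
by rewrite -fo; exact: fs.
Qed.

End BushLocality.

Lemma local_cheap_walk D n : local_property (fun M : marked D 2 =>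
  cheap_walk n (tnth (marks M) ord0) (tnth (marks M) (lift ord0 ord0))).
Proof.
move=> M [p [yp py pn]].
have := locallyI (locallyI (locally_mark M ord0) (locally_mark M (lift ord0 ord0)))
  (locallyI (locally_path (R := @adj D) (@locally_adj _ _ M) yp)
     (locally_cost (tnth (marks M) (lift ord0 ord0)) p)).
apply: locallyS => N f [[fx fy] [fp fc]]; exists (map f p).
by rewrite -fy last_map py fx (leq_trans fc).
Qed.

Section TwoEndRandom.
Variables (R : realType) (D : nat) (disp : measure_display).
Variables (Omega : measurableType disp) (P : probability Omega R).
Variable T : {RV P >-> iso_space D 1}.

Definition bush_bound n k := (2 * n.+1 * k)%N.

(** Each vertex sends mass 1 to the vertices of small bushes that it reaches at cost
    at most [n], and a vertex in a small bush receives mass from its whole ball.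
    Restricting to bushes of bounded size bounds the mass sent; almost surely the
    bush of the root is finite, so letting the bound grow loses nothing. *)
Lemma two_ended_uncrowded : unimodular_tree T ->
  {ae P, forall w, two_ended (T w)} ->
  {ae P, forall w, exists k N, forall n, (N <= n)%N ->
    ~ crowded n (n.+1 ^ 2 * bush_bound n k.+1) (repr (T w : iso_class D 1))}.
Proof.
move=> [uniT treeT] twoT.
have {treeT twoT} TT : {ae P, forall w, is_tree (rep_graph (T w)) /\ two_ended (T w)}.
  by apply: filterS2 treeT twoT.
pose Big k := class_with (fun M : marked D 1 => big_bush k (tnth (marks M) ord0)).
have mBig k : measurable (Big k) by exact: (local_measurable (@local_big_bush D 0 k ord0)).
suff : forall k, {ae P, forall w, exists N, forall n, (N <= n)%N ->
    ~ (class_with (@crowded D n (n.+1 ^ 2 * bush_bound n k.+1)) `\` Big k.+1) (T w)}.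
  move=> /ae_foralln H; apply: filterS2 TT H => w [tw tow] H.
  have [r [s [endrs nrs]]] := two_end_rays tow.
  have [k Hk] := bush_finite tw endrs nrs (Defs.root (T w)).
  exists k; have [N HN] := H k; exists N => n /HN nc cr; apply: nc; split=> //.
  move=> [t [Ut kt Ht]]; apply: Hk; exists t; split=> //; exact: ltnW.
move=> k; pose C n := bush_bound n k.+1.
pose E n := class_with (@crowded D n (n.+1 ^ 2 * C n)) `\` Big k.+1.
have mE n : measurable (E n).
  by apply: measurableD => //; apply: local_measurable; exact: local_crowded.
apply: (@ae_eventually_not _ _ _ P (fun n => T @^-1` E n)) => n.
  by rewrite -[X in measurable X]setTI; exact: measurable_funP.
have C0 : (0 < C n)%N by rewrite !muln_gt0.
pose walks := class_with (fun M : marked D 2 =>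
  cheap_walk n (tnth (marks M) ord0) (tnth (marks M) (lift ord0 ord0))).
pose bigs := class_with (fun M : marked D 2 =>
  big_bush k.+1 (tnth (marks M) (lift ord0 ord0))).
have walksP (G : graph D) (x y : vertex G) :
    walks (class_of [tuple x; y]) <-> cheap_walk n x y.
  exact: (local_class _ (@local_cheap_walk D n)).
have bigsP (G : graph D) (x y : vertex G) :
    bigs (class_of [tuple x; y]) <-> big_bush k.+1 y.
  exact: (local_class _ (@local_big_bush D 1 k.+1 (lift ord0 ord0))).
have : ((n.+1 ^ 2 * C n)%:R%:E * P (T @^-1` E n) <= (C n)%:R%:E)%E.
  apply: (mass_transport_bound uniT (A := walks `\` bigs)) => //.
  - apply: measurableD; first exact: (local_measurable (@local_cheap_walk D n)).
    exact: (local_measurable (@local_big_bush D 1 k.+1 (lift ord0 ord0))).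
  - apply: filterS TT => w [tw tow].
    have [r [s [endrs nrs]]] := two_end_rays tow.
    have [l [lC Hl]] := cheap_walks_listed tw endrs nrs k.+1 n (Defs.root (T w)).
    by exists l; split=> // y [/walksP xy /bigsP ny]; exact: Hl.
  - apply: filterS TT => w [tw tow] [[s [Us ms Hs]] nbig].
    exists s; split=> // x /Hs[p [op px pn]]; split; last by move=> /bigsP.
    apply/walksP; exists p; split=> //; exact: leq_trans (cost_size _ _) pn.
rewrite natrM EFinM muleAC => h.
have Cp : (0 < (C n)%:R :> R)%R by rewrite ltr0n.
by rewrite -(@lee_pmul2r _ (C n)%:R%:E) ?mul1e.
Qed.

End TwoEndRandom.

(** * From ball sizes to growth rates *)
Section Balls.
Variables (D : nat) (G : graph D).
Implicit Types x y : vertex G.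

Lemma graph_ballS x n y : graph_ball x n.+1 y <->
  graph_ball x n y \/ exists2 z, graph_ball x n z & adj z y.
Proof.
split=> [[p [xp py]]|[[p [xp py pn]]|[z [p [xp pz pn]] zy]]].
- rewrite leq_eqVlt => /orP[/eqP|pn]; last by left; exists p.
  case/lastP: p xp py => // p z; rewrite rcons_path last_rcons size_rcons.
  move=> /andP[xp pz] <- [pn]; right; exists (last x p) => //.
  by exists p; rewrite pn.
- by exists p; rewrite leqW.
- exists (rcons p y).
  by rewrite rcons_path last_rcons size_rcons xp pz.
Qed.

Lemma ball_finite x n : finite_set (graph_ball x n).
Proof.
suff [l Hl] : listed (graph_ball x n).
  by apply: sub_finite_set (finite_seq l) => y /Hl.
elim: n => [|n [l Hl]].
  by exists [:: x] => y [p [_ <-]]; rewrite leqn0 size_eq0 => /eqP ->; rewrite inE.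
exists (l ++ flatten [seq nbrs z | z <- l]) => y /graph_ballS[/Hl yl|[z /Hl zl zy]].
  by rewrite mem_cat yl.
rewrite mem_cat; apply/orP; right; apply/flattenP; exists (nbrs z).
  exact: map_f.
by rewrite mem_nbrs.
Qed.

End Balls.

Section Growth.
Variable R : realType.

Definition ball_size (D : nat) (c : iso_space D 1) (n : nat) : nat :=
  #|` fset_set (graph_ball (Defs.root c) n)|.

Lemma ball_size_lt D (c : iso_space D 1) n m :
  ~ crowded n m (repr (c : iso_class D 1)) -> (ball_size c n < m)%N.
Proof.
move=> nc; rewrite ltnNge; apply/negP => mB; apply: nc.
exists (fset_set (graph_ball (Defs.root c) n) : seq _); split=> //.
  exact: fset_uniq.
by move=> x; rewrite in_fset_set; [move/set_mem|exact: ball_finite].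
Qed.

Lemma ball_size_gt0 D (c : iso_space D 1) n : (0 < ball_size c n)%N.
Proof.
rewrite cardfs_gt0; apply/fset0Pn; exists (Defs.root c).
by rewrite in_fset_set; [apply/mem_set; exists [::]|exact: ball_finite].
Qed.

(** Bernoulli's inequality provides one factor [n.+1] at the price of a square root
    of the basis; the degree is treated by induction. *)
Lemma poly_lt_exp (p : nat) (K e : R) : 0 < e ->
  exists N, forall n, (N <= n)%N -> K * n.+1%:R ^+ p <= (1 + e) ^+ n.
Proof.
have bern (x : R) n : 0 <= x -> 1 + n%:R * x <= (1 + x) ^+ n.
  move=> x0; elim: n => [|n IHn]; first by rewrite expr0 mul0r addr0.
  rewrite exprS -natr1; apply: le_trans (ler_wpM2l _ IHn); last by lra.
  have : 0 <= n%:R * x * x by rewrite !mulr_ge0.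
  by rewrite mulrDl mul1r mulrDr mulr1; lra.
elim: p K e => [|p IHp] K e e0.
  have := archi_boundP (normr_ge0 (K / e)); set N := Num.bound _ => KN.
  exists N => n Nn; rewrite expr0 mulr1; apply: le_trans (bern e n (ltW e0)).
  have : K / e <= n%:R.
    apply: le_trans (ler_norm _) _; apply: ltW; apply: lt_le_trans KN _.
    by rewrite ler_nat.
  by rewrite ler_pdivrMr //; lra.
pose e' := Num.min (e / 3) 1.
have e'0 : 0 < e' by rewrite lt_min; apply/andP; split; lra.
have [e'e e'1] : e' <= e / 3 /\ e' <= 1 by rewrite !ge_min !lexx orbT.
have [N HN] := IHp (K / e') e' e'0; exists N => n /HN IH.
have h1 : n.+1%:R * e' <= (1 + e') ^+ n.
  apply: le_trans (bern e' n (ltW e'0)); rewrite -natr1 mulrDl mul1r; lra.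
have [K0|K0] := lerP 0 K; last first.
  apply: (@le_trans _ _ 0); last by rewrite exprn_ge0; lra.
  by rewrite mulr_le0_ge0 ?exprn_ge0 //; exact: ltW.
have h2 : (1 + e') * (1 + e') <= 1 + e.
  have : e' * e' <= e' * 1 by rewrite ler_wpM2l // ltW.
  by rewrite mulrDl mulrDr !mul1r mulr1 mulrDr; lra.
apply: (@le_trans _ _ (((1 + e') * (1 + e')) ^+ n)); last first.
  by apply: lerXn2r => //; rewrite nnegrE; [rewrite mulr_ge0; lra|lra].
rewrite exprMn; apply: le_trans (ler_pM _ _ IH h1); last 2 first.
- by rewrite mulr_ge0 ?exprn_ge0 // divr_ge0 // ltW.
- by rewrite mulr_ge0 // ltW.
rewrite exprS le_eqVlt; apply/orP; left; apply/eqP.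
move: (n.+1%:R : R) (n.+1%:R ^+ p : R) => x y.
have -> : K / e' * y * (x * e') = (e'^-1 * e') * (K * (x * y)) by lra.
by rewrite mulVf ?mul1r // gt_eqF.
Qed.

Lemma growth_bound D (c : iso_space D 1) (b K : R) (p : nat) : 0 <= b ->
  (exists N, forall n, (N <= n)%N -> (ball_size c n)%:R <= K * n.+1%:R ^+ p * b ^+ n) ->
  forall e : R, 0 < e -> \forall n \near \oo, growth R c n <= (1 + e) * b.
Proof.
move=> b0 [N HN] e e0; have [M HM] := poly_lt_exp p K e0.
exists (maxn 1 (maxn N M)) => // n /=; rewrite !geq_max => /and3P[n0 /HN Bn /HM Kn].
have eb : 0 <= (1 + e) * b by rewrite mulr_ge0 //; lra.
have -> : (1 + e) * b = (((1 + e) * b) ^+ n) `^ n%:R^-1.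
  rewrite -powR_mulrn // -powRrM mulfV ?powRr1 // pnatr_eq0; lia.
apply: ge0_ler_powR; rewrite ?nnegrE ?exprn_ge0 ?invr_ge0 //.
apply: (le_trans Bn); rewrite exprMn ler_wpM2r ?exprn_ge0 //.
Qed.

Lemma growth_ge1 D (c : iso_space D 1) n : 1 <= growth R c n.
Proof.
have -> : 1 = (1 : R) `^ n%:R^-1 by rewrite powR1.
rewrite /growth.
apply: ge0_ler_powR; rewrite ?nnegrE ?invr_ge0 ?ler01 // ler1n.
exact: ball_size_gt0.
Qed.

Lemma growth_cvg1 D (c : iso_space D 1) (K : R) (p : nat) :
  (exists N, forall n, (N <= n)%N -> (ball_size c n)%:R <= K * n.+1%:R ^+ p) ->
  growth R c @ \oo --> (1 : R).
Proof.
move=> [N HN]; apply/cvgrPdist_le => e e0.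
have H : exists N, forall n, (N <= n)%N ->
    (ball_size c n)%:R <= K * n.+1%:R ^+ p * 1 ^+ n :> R.
  by exists N => n /HN; rewrite expr1n mulr1.
apply: filterS (growth_bound ler01 H e0) => n gn.
have g1 := growth_ge1 c n.
by rewrite ler0_norm; lra.
Qed.

Lemma growth_limsup D (c : iso_space D 1) (b K : R) (p : nat) : 0 <= b ->
  (exists N, forall n, (N <= n)%N -> (ball_size c n)%:R <= K * n.+1%:R ^+ p * b ^+ n) ->
  (limn_esup (fun n => (growth R c n)%:E) <= b%:E)%E.
Proof.
move=> b0 H; apply/lee_addgt0Pr => d d0.
have e0 : 0 < d / (b + 1) by rewrite divr_gt0 //; lra.
have := growth_bound b0 H e0 => near_le.
apply: ereal_inf_le; exists (ereal_sup [set (growth R c n)%:E |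
    n in [set n | growth R c n <= (1 + d / (b + 1)) * b]]).
  by exists [set n | growth R c n <= (1 + d / (b + 1)) * b].
apply: ge_ereal_sup => _ [n /= gn <-]; rewrite -EFinD lee_fin.
apply: (le_trans gn); rewrite mulrDl mul1r lerD2l.
rewrite -mulrA ger_pMr // mulrC ler_pdivrMr; lra.
Qed.

End Growth.

Section HyperfiniteTrees.
Variables (R : realType) (d : nat) (disp : measure_display).
Variables (Omega : measurableType disp) (P : probability Omega R).
Variable T : {RV P >-> iso_space d 1}.
Hypothesis uniT : unimodular_tree T.

Lemma two_ended_growth : {ae P, forall w, two_ended (T w)} ->
  {ae P, forall w, growth R (T w) @ \oo --> (1 : R)}.
Proof.
move=> /(two_ended_uncrowded uniT); apply: filterS => w [k [N HN]].
apply: (@growth_cvg1 _ _ _ (2 * k.+1%:R) 3); exists N => n /HN/ball_size_lt Bn.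
apply: (@le_trans _ _ (n.+1 ^ 2 * bush_bound n k.+1)%:R); first by rewrite ler_nat ltnW.
rewrite /bush_bound -natrX -!natrM ler_nat; nia.
Qed.

Lemma one_ended_growth : {ae P, forall w, one_ended (T w)} ->
  {ae P, forall w, (limn_esup (fun n => (growth R (T w) n)%:E)
     <= (Num.sqrt (d%:R - 1))%:E)%E}.
Proof.
move=> oneT; have := one_ended_uncrowded uniT oneT.
have [_ treeT] := uniT.
apply: filterS3 oneT treeT => w ow tw [N HN].
have [r endr] := one_end_ray ow; have d1 := one_end_degree tw endr.
have sqd : d%:R - 1 = d.-1%:R :> R by rewrite -subn1 natrB // ltnW.
have b1 : 1 <= Num.sqrt (d%:R - 1 : R).
  by rewrite sqd -[X in X <= _]sqrtr1 ler_sqrt ?ltr01 // ler1n; lia.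
apply: (@growth_limsup _ _ _ _ 2 4); first exact: sqrtr_ge0.
exists N => n /HN/ball_size_lt/ltnW Bn.
apply: (@le_trans _ _ ((n.+1 ^ 2).+1 * confluent_bound d n)%:R); first by rewrite ler_nat.
apply: (@le_trans _ _ ((2 * n.+1 ^ 4)%:R * (d.-1 ^ n./2)%:R)).
  rewrite -natrM ler_nat /confluent_bound mulnA leq_mul2r; apply/orP; right.
  nia.
rewrite natrM natrX; apply: ler_wpM2l; first by rewrite mulr_ge0 ?exprn_ge0.
rewrite natrX -sqd; set b := Num.sqrt _ in b1 *.
have -> : d%:R - 1 = b ^+ 2 by rewrite sqr_sqrtr // sqd.
rewrite -exprM mul2n; apply: ler_weXn2l => //.
by rewrite -[leqRHS]odd_double_half leq_addl.
Qed.

End HyperfiniteTrees.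

(** * A canopy tree that branches at some heights only *)
(** Says that the vertices at height [h.+1] have two children rather than one. It
    holds from [2 ^ (4 i)] to [2 ^ (4 i + 1)], excluded, and fails from there to
    [2 ^ (4 i + 4)]; at 0 it holds since the logarithm of 0 is 0. *)
Definition branching (h : nat) : bool := (4 %| trunc_log 2 h)%N.

(** The number of branchings below height [h]: a vertex at height [h] has
    [2 ^ level h] descendants at height 0. *)
Definition level (h : nat) : nat := count branching (iota 0 h).

Lemma levelS h : level h.+1 = (level h + branching h)%N.
Proof. by rewrite /level -addn1 iotaD count_cat /= addn0. Qed.

Lemma level_leq h k : (h <= k)%N -> (level h <= level k)%N.
Proof. by move=> /subnKC <-; rewrite /level iotaD count_cat leq_addr. Qed.

Lemma level_le h : (level h <= h)%N.
Proof. by rewrite -[X in (_ <= X)%N](size_iota 0) count_size. Qed.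

(** The height at which the block of index [i] starts. *)
Definition scale (i : nat) : nat := (2 ^ (4 * i))%N.

Lemma branching_on i h : (scale i <= h < 2 * scale i)%N -> branching h.
Proof.
by move=> H; rewrite /branching (trunc_log_eq (n := 4 * i)) // ?dvdn_mulr // expnS.
Qed.

Lemma branching_off i h : (2 * scale i <= h < 16 * scale i)%N -> ~~ branching h.
Proof.
move=> /andP[h1 h2].
have l1 : ((4 * i).+1 <= trunc_log 2 h)%N by apply: trunc_log_max; rewrite // expnS.
have l2 : (trunc_log 2 h < 4 * i.+1)%N.
  have h0 : (0 < h)%N by apply: leq_trans h1; rewrite muln_gt0 expn_gt0.
  rewrite -(@ltn_exp2l 2) //; apply: leq_ltn_trans (trunc_logP (isT : 1 < 2)%N h0) _.
  by rewrite mulnS expnD.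
by rewrite /branching; apply/negP => /dvdnP[q qE]; lia.
Qed.

Lemma level_branching i : level (2 * scale i) = (level (scale i) + scale i)%N.
Proof.
rewrite mul2n -addnn /level iotaD count_cat add0n; congr addn.
rewrite (eq_in_count (a2 := predT)) ?count_predT ?size_iota // => h.
by rewrite mem_iota => H; rewrite (@branching_on i) // mul2n -addnn.
Qed.

Lemma level_flat i : (level (16 * scale i) <= 2 * scale i)%N.
Proof.
have -> : (16 * scale i = 2 * scale i + 14 * scale i)%N by rewrite -mulnDl.
rewrite /level iotaD count_cat -[X in (_ <= X)%N]addn0; apply: leq_add.
  exact: level_le.
rewrite leqn0 (eq_in_count (a2 := pred0)) ?count_pred0 // => h.
rewrite mem_iota add0n -mulnDl => H; exact/negbTE/(@branching_off i).
Qed.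

(** Linear growth of [level], which makes the weights [2 ^ - level h] summable. *)
Lemma level_ge h : (h %/ 32 <= level h)%N.
Proof.
have [h2|h2] := ltnP h 2; first by rewrite divn_small // (ltn_trans h2).
pose i := (trunc_log 2 (h %/ 2) %/ 4)%N.
have h20 : (0 < h %/ 2)%N by rewrite divn_gt0.
have hi : (2 * scale i <= h)%N.
  rewrite mulnC -leq_divRL //; apply: leq_trans (trunc_logP (isT : 1 < 2)%N h20).
  by rewrite /scale leq_exp2l // mulnC leq_divM.
have ih : (h < 32 * scale i)%N.
  have : (h %/ 2 < 2 ^ (trunc_log 2 (h %/ 2)).+1)%N by exact: trunc_log_ltn.
  rewrite ltn_divLR // => /leq_trans; apply.
  have -> : (32 * scale i = 2 ^ (5 + 4 * i))%N by rewrite expnD.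
  rewrite -expnSr leq_exp2l //.
  have := divn_eq (trunc_log 2 (h %/ 2)) 4; rewrite -/i.
  by have := ltn_pmod (trunc_log 2 (h %/ 2)) (isT : 0 < 4)%N; lia.
apply: (@leq_trans (scale i)); first by rewrite ltnW // ltn_divLR // mulnC.
by apply: leq_trans (level_leq hi); rewrite level_branching leq_addl.
Qed.

(** The vertex [(h, x)] is the one of number [x] at height [h]. Taking the parent
    drops the last binary digit of [x], if there is a branching, and keeps [x]
    otherwise. *)
Definition up (v : nat * nat) : nat * nat :=
  (v.1.+1, if branching v.1 then v.2./2 else v.2).

Definition canopy_adj : rel (nat * nat) := fun u v => (up u == v) || (up v == u).

Lemma iter_up n h x : iter n up (h, x) = ((h + n)%N, (x %/ 2 ^ (level (h + n) - level h))%N).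
Proof.
elim: n => [|n IHn]; first by rewrite /= addn0 subnn divn1.
rewrite iterS IHn /up /= addnS levelS; congr pair.
case: ifP => _; last by rewrite addn0.
by rewrite -divn2 -divnMA -expnSr addn1 subSn // level_leq ?leq_addr.
Qed.

Lemma iter_up0 n h : iter n up (h, 0%N) = ((h + n)%N, 0%N).
Proof. by rewrite iter_up div0n. Qed.

(** Every vertex eventually lands on the spine of vertices [(h, 0)], since all its
    binary digits get dropped. *)
Lemma reach_spine v : exists N, forall n, (N <= n)%N -> iter n up v = ((v.1 + n)%N, 0%N).
Proof.
case: v => h x; exists (32 * (level h + x).+1)%N => n Nn; rewrite iter_up /=.
rewrite divn_small //; apply: leq_trans (ltn_expl x (isT : 1 < 2)%N) _.
rewrite leq_exp2l //.
have : (level h + x < level (h + n))%N.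
  apply: leq_trans (level_ge _); rewrite leq_divRL // mulnC.
  exact: leq_trans Nn (leq_addl _ _).
by lia.
Qed.

Lemma up_neq v : up v != v.
Proof. by apply/eqP => /(congr1 fst) /= /eqP; rewrite eqn_leq ltnn. Qed.

Lemma canopy_sym : symmetric canopy_adj.
Proof. by move=> u v; rewrite /canopy_adj orbC. Qed.

Lemma canopy_irr : irreflexive canopy_adj.
Proof. by move=> v; rewrite /canopy_adj orbb; exact/negbTE/up_neq. Qed.

Lemma path_up n v : exists p, path canopy_adj v p /\ last v p = iter n up v.
Proof.
elim: n => [|n [p [vp pv]]]; first by exists [::].
exists (rcons p (iter n.+1 up v)).
by rewrite rcons_path vp last_rcons pv /canopy_adj iterS eqxx.
Qed.

Lemma canopy_conn u v : exists2 p, path canopy_adj u p & last u p = v.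
Proof.
have [N HN] := reach_spine u; have [M HM] := reach_spine v.
have [p [up_ pu]] := path_up (N + M + v.1) u.
have [q [vq qv]] := path_up (N + M + u.1) v.
pose w := ((u.1 + v.1 + N + M)%N, 0%N).
have {}pu : last u p = w.
  by rewrite pu HN /w; [congr pair; lia|lia].
have {}qv : last v q = w.
  by rewrite qv HM /w; [congr pair; lia|lia].
have [q' [q'v q'u _]] := sym_path_rev canopy_sym vq; rewrite qv in q'v q'u.
by exists (p ++ q'); rewrite ?last_cat ?cat_path pu ?up_.
Qed.

Definition canopy_nbrs (v : nat * nat) : seq (nat * nat) :=
  [:: up v; (v.1.-1, if branching v.1.-1 then v.2.*2 else v.2); (v.1.-1, v.2.*2.+1)].

Lemma mem_canopy_nbrs u v : canopy_adj u v -> v \in canopy_nbrs u.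
Proof.
move=> /orP[/eqP <-|/eqP <-]; first exact: mem_head.
case: v => h x; rewrite /canopy_nbrs /up /=.
case: (branching h); last by rewrite in_cons mem_head orbT.
have := odd_double_half x; case: (odd x) => xE; rewrite 2!in_cons mem_seq1.
  by apply/or3P; constructor 3; rewrite -{1}xE.
by apply/or3P; constructor 2; rewrite -{1}xE.
Qed.

(** * Translations of the canopy tree *)
Lemma half_lxor a b :
  (PeanoNat.Nat.lxor a b)./2 = PeanoNat.Nat.lxor a./2 b./2.
Proof.
have halfE n : n./2 = Nat.div2 n /\ n.+1./2 = Nat.div2 n.+1.
  by elim: n => [//|n [IH1 IH2]]; split=> //=; rewrite -IH1.
have hE n : n./2 = PeanoNat.Nat.shiftr n 1 by case: (halfE n).
by rewrite !hE PeanoNat.Nat.shiftr_lxor.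
Qed.

(** Adding the binary digits of [g] without carries, read from the digits that
    remain at the given height. These automorphisms act transitively on each
    height. *)
Definition translate (g : nat) (v : nat * nat) : nat * nat :=
  (v.1, PeanoNat.Nat.lxor v.2 (g %/ 2 ^ level v.1)).

Lemma translateK g : involutive (translate g).
Proof.
case=> h x; congr pair; rewrite /= PeanoNat.Nat.lxor_assoc.
by rewrite PeanoNat.Nat.lxor_nilpotent PeanoNat.Nat.lxor_0_r.
Qed.

Lemma translate_up g v : translate g (up v) = up (translate g v).
Proof.
case: v => h x; rewrite /translate /up /= levelS; congr pair.
case: ifP => _; last by rewrite addn0.
by rewrite half_lxor addn1 expnSr divnMA divn2.
Qed.

Lemma translate_adj g : {mono translate g : u v / canopy_adj u v}.
Proof.
move=> u v; rewrite /canopy_adj -!translate_up.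
by rewrite !(inj_eq (inv_inj (translateK g))).
Qed.

Lemma translate_spine g h : translate g (h, 0%N) = (h, (g %/ 2 ^ level h)%N).
Proof. by rewrite /translate /= PeanoNat.Nat.lxor_0_l. Qed.

Lemma translate_to_spine g h : translate g (h, (g %/ 2 ^ level h)%N) = (h, 0%N).
Proof. by rewrite /translate /= PeanoNat.Nat.lxor_nilpotent. Qed.

(** * The canopy tree as a graph *)
(** Vertices of a graph are natural numbers, so pairs are encoded. *)
Definition is_code (n : nat) : bool := isSome (pickle_inv n : option (nat * nat)).

Lemma is_code_pickle (v : nat * nat) : is_code (choice.pickle v).
Proof. by rewrite /is_code pickleK_inv. Qed.

Definition vertex_of (v : nat * nat) : {n : nat | is_code n} :=
  exist (fun n : nat => is_code n) (choice.pickle v) (is_code_pickle v).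

Definition coords (a : {n : nat | is_code n}) : nat * nat :=
  odflt (0%N, 0%N) (pickle_inv (sval a)).

Lemma vertex_ofK : cancel vertex_of coords.
Proof. by move=> v; rewrite /coords /= pickleK_inv. Qed.

Lemma coordsK : cancel coords vertex_of.
Proof.
move=> [n nc]; apply: val_inj => /=; rewrite /coords /=.
move: nc (@pickle_invK (nat * nat)%type n); rewrite /is_code.
by case: (pickle_inv n).
Qed.

Lemma canopy_code_conn (a b : {n | is_code n}) :
  exists2 p, path (relpre coords canopy_adj) a p & last a p = b.
Proof.
have [p ap pb] := canopy_conn (coords a) (coords b).
exists (map vertex_of p); last by rewrite -[a]coordsK last_map pb coordsK.
rewrite -[a]coordsK path_map; apply: sub_path ap => u v /=.
by rewrite !vertex_ofK.
Qed.

Lemma canopy_code_deg (a : {n | is_code n}) :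
  ([set b | relpre coords canopy_adj a b] #<= `I_3)%card.
Proof.
pose l := map vertex_of (canopy_nbrs (coords a)).
apply: card_le_trans (card_image_le (nth a l) `I_3).
apply: subset_card_le => b /= /mem_canopy_nbrs/(map_f vertex_of); rewrite coordsK -/l => bl.
by exists (index b l); [have := bl; rewrite -index_mem|exact: nth_index].
Qed.

Definition canopy : graph 3 := @Graph 3 is_code (relpre coords canopy_adj)
  (fun a b => canopy_sym (coords a) (coords b)) (fun a => canopy_irr (coords a))
  canopy_code_conn canopy_code_deg.

(** * Geometry of the copies of the canopy tree *)
Lemma min_in_seq (T : eqType) (f : T -> nat) (x : T) (s : seq T) :
  exists2 y, y \in x :: s & forall z, z \in x :: s -> (f y <= f z)%N.
Proof.
elim: s x => [|a s IHs] x.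
  by exists x; rewrite ?mem_head // => z; rewrite inE => /eqP ->.
have [y ys Hy] := IHs a; have [xy|yx] := leqP (f x) (f y).
  exists x; rewrite ?mem_head // => z; rewrite inE => /orP[/eqP -> //|/Hy].
  exact: leq_trans.
exists y; first by rewrite inE ys orbT.
by move=> z; rewrite inE => /orP[/eqP ->|/Hy //]; exact: ltnW.
Qed.

Section CanopyCopies.
Variables (G : graph 3) (phi : nat * nat -> vertex G) (psi : vertex G -> nat * nat).
Hypotheses (phiK : cancel phi psi) (psiK : cancel psi phi).
Hypothesis phi_adj : forall u v, adj (phi u) (phi v) = canopy_adj u v.

Let adj_psi x y : adj x y = canopy_adj (psi x) (psi y).
Proof. by rewrite -phi_adj !psiK. Qed.

(** In a cycle, both neighbours of a vertex of least height would be its image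
    under [up]. *)
Lemma canopy_tree : is_tree G.
Proof.
move=> [c c2 /andP[cyc Uc]].
case: c c2 cyc Uc => [//|a c] c2 cyc Uc.
have [x xc minx] := min_in_seq (fun x => (psi x).1) a c.
have [i c' rotE] := rot_to xc.
have {}cyc : cycle (@adj 3 G) (x :: c') by rewrite -rotE rot_cycle.
have {}Uc : uniq (x :: c') by rewrite -rotE rot_uniq.
have {}c2 : (2 < size (x :: c'))%N by rewrite -rotE size_rot.
have {}minx z : z \in x :: c' -> ((psi x).1 <= (psi z).1)%N.
  by rewrite -rotE mem_rot; exact: minx.
case: c' {rotE} cyc Uc c2 minx => [//|y t] cyc Uc c2 minx.
have lowest z : z \in x :: y :: t -> adj x z -> psi z = up (psi x).
  move=> /minx; rewrite adj_psi => xz /orP[/eqP //|/eqP zx].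
  by move: xz; rewrite -zx /= ltnn.
have lt : last y t \in y :: t := mem_last _ _.
move: cyc; rewrite /= rcons_path => /andP[xy /andP[_ tx]].
have yE : psi y = up (psi x) by apply: lowest; rewrite // !inE eqxx orbT.
have zE : psi (last y t) = up (psi x).
  by apply: lowest; [rewrite in_cons lt orbT|rewrite adjC].
have yz : y = last y t by apply: (can_inj psiK); rewrite yE zE.
move: Uc => /= /andP[_ /andP[yt _]].
by case: t c2 yz yt {minx lowest lt tx zE} => [//|b t] _ /= -> ; rewrite mem_last.
Qed.

Definition spine (h : nat) : vertex G := phi (h, 0%N).

Lemma spine_ray : is_ray spine.
Proof.
split; first by move=> h k /(can_inj phiK)[].
by move=> h; rewrite phi_adj /canopy_adj /up /= if_same eqxx.
Qed.

(** A ray that goes down once keeps going down, which heights do not allow. *)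
Lemma canopy_ray r i : is_ray r -> psi (r i.+1) = up (psi (r i)).
Proof.
move=> [rinj radj].
have step j : psi (r j.+1) = up (psi (r j)) \/ up (psi (r j.+1)) = psi (r j).
  by have := radj j; rewrite adj_psi => /orP[/eqP|/eqP]; [left|right].
have [//|down] := step i.
have downs k : up (psi (r (i + k).+1)) = psi (r (i + k)%N).
  elim: k => [|k IHk]; first by rewrite addn0.
  rewrite addnS; have [E|//] := step (i + k).+1.
  by have := rinj _ _ (can_inj psiK (etrans E IHk)); lia.
suff H k : ((psi (r (i + k)%N)).1 + k = (psi (r i)).1)%N.
  by have := H (psi (r i)).1.+1; lia.
elim: k => [|k IHk]; first by rewrite !addn0.
by rewrite -IHk -(downs k) /= !addnS addSn.
Qed.

Lemma canopy_ray_spine r : is_ray r -> same_end r spine.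
Proof.
move=> rr K.
have rE i : psi (r i) = iter i up (psi (r 0%N)).
  by elim: i => //= i <-; rewrite canopy_ray.
have [N HN] := reach_spine (psi (r 0%N)).
have [M HM] := same_end_refl spine_ray K.
exists (N + M)%N => i j Ni Nj.
have -> : r i = spine ((psi (r 0%N)).1 + i)%N by rewrite /spine -HN ?[iter _ _ _]/= -?rE ?psiK //; lia.
by apply: HM; lia.
Qed.

Lemma canopy_one_ended : (ends G #= `I_1)%card.
Proof.
suff -> : ends G = [set [set s | is_ray s /\ same_end spine s]] by exact: card_set1.
apply/seteqP; split=> [_ [r rr <-]|_ ->]; last by exists spine => //; exact: spine_ray.
apply/(end_classP _ spine_ray); exact: canopy_ray_spine.
Qed.

Lemma iter_up_ball u v j k : iter j up u = iter k up v ->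
  graph_ball (phi u) (j + k) (phi v).
Proof.
elim: k v => [|k IHk] v.
  rewrite addn0 => /= <-; elim: j => [|j IHj]; first by exists [::].
  apply/graph_ballS; right; exists (phi (iter j up u)) => //.
  by rewrite phi_adj /canopy_adj eqxx.
rewrite iterSr addnS => /IHk H; apply/graph_ballS; right; exists (phi (up v)) => //.
by rewrite phi_adj /canopy_adj eqxx orbT.
Qed.

Lemma canopy_ball n u x : graph_ball (phi u) n x ->
  exists k, iter k up (psi x) = iter n up u.
Proof.
elim: n x => [|n IHn] x.
  by move=> [p [_ <-]]; rewrite leqn0 size_eq0 => /eqP ->; exists 0%N; rewrite phiK.
move=> /graph_ballS[/IHn[k E]|[z /IHn[k E]]].
  by exists k.+1; rewrite !iterS E.
rewrite adj_psi => /orP[/eqP zx|/eqP xz].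
  by exists k; rewrite -zx -iterSr !iterS E.
by exists k.+2; rewrite iterS iterSr xz E.
Qed.

(** From height [h] climb to height [2 L], where [L] is the start of a block, and
    then descend to height [L]: the whole block of branchings has been crossed,
    within distance [3 L]. *)
Lemma canopy_ball_large h i : (h <= 2 * scale i)%N ->
  exists s : seq (vertex G), [/\ uniq s, size s = (2 ^ scale i)%N &
    forall x, x \in s -> graph_ball (spine h) (3 * scale i) x].
Proof.
move=> hL; exists [seq phi (scale i, y) | y <- iota 0 (2 ^ scale i)].
rewrite size_map size_iota map_inj_uniq ?iota_uniq; last by move=> y z /(can_inj phiK)[].
split=> // _ /mapP[y + ->]; rewrite mem_iota add0n => /= yL.
have : graph_ball (spine h) ((2 * scale i - h) + scale i) (phi (scale i, y)).
  apply: iter_up_ball; rewrite iter_up0 iter_up subnKC // addnn -mul2n.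
  by rewrite level_branching addKn divn_small.
move=> [p [hp py pn]]; exists p; split=> //; apply: leq_trans pn _; lia.
Qed.

(** Balls of radius [n] stay among the descendants of the [n]-th ancestor. *)
Lemma canopy_ball_small h n : exists s : seq (vertex G),
  (size s <= (h + n).+1 * 2 ^ level (h + n))%N /\
  forall x, graph_ball (spine h) n x -> x \in s.
Proof.
exists [seq phi (m, y) | m <- iota 0 (h + n).+1, y <- iota 0 (2 ^ level (h + n))].
rewrite size_allpairs !size_iota; split=> // x /canopy_ball[k].
rewrite iter_up0; case E : (psi x) => [m y]; rewrite iter_up => -[mk y0].
apply/allpairsP; exists (m, y); rewrite !mem_iota /= !add0n -E psiK; split=> //; first lia.
rewrite mk in y0.
have : (y < 2 ^ (level (h + n) - level m))%N.
  by rewrite ltnNge -divn_gt0 ?expn_gt0 // y0.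
by move/leq_trans; apply; rewrite leq_exp2l // leq_subr.
Qed.

End CanopyCopies.

(** * The canopy tree has no growth rate *)
Section NoGrowth.
Variable R : realType.
Variables (c : iso_space 3 1) (phi : nat * nat -> vertex (rep_graph c)).
Variables (psi : vertex (rep_graph c) -> nat * nat) (h : nat).
Hypotheses (phiK : cancel phi psi) (psiK : cancel psi phi).
Hypothesis phi_adj : forall u v, adj (phi u) (phi v) = canopy_adj u v.
Hypothesis rootE : Defs.root c = phi (h, 0%N).

Lemma ball_size_ge n (s : seq (vertex (rep_graph c))) : uniq s ->
  (forall x, x \in s -> graph_ball (Defs.root c) n x) -> (size s <= ball_size c n)%N.
Proof.
move=> Us Hs; apply: uniq_leq_size Us _ => x /Hs xB.
by rewrite in_fset_set; [exact/mem_set|exact: ball_finite].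
Qed.

Lemma ball_size_le n (s : seq (vertex (rep_graph c))) :
  (forall x, graph_ball (Defs.root c) n x -> x \in s) -> (ball_size c n <= size s)%N.
Proof.
move=> Hs; apply: uniq_leq_size; first exact: fset_uniq.
by move=> x; rewrite in_fset_set; [move=> /set_mem/Hs|exact: ball_finite].
Qed.

(** Radius [3 L] and [2 ^ L] vertices give the exponent 1/3. *)
Lemma growth_large i : (h <= 2 * scale i)%N ->
  2 `^ (3%:R^-1) <= growth R c (3 * scale i).
Proof.
move=> hi; have [s [Us sL Hs]] := canopy_ball_large phiK phi_adj hi.
have L0 : (scale i)%:R != 0 :> R by rewrite pnatr_eq0 -lt0n expn_gt0.
have -> : 3%:R^-1 = (scale i)%:R * (3 * scale i)%:R^-1 :> R.
  by rewrite natrM invfM mulrCA mulfV // mulr1.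
rewrite powRrM powR_mulrn // -natrX; apply: ge0_ler_powR; rewrite ?nnegrE ?invr_ge0 //.
by rewrite ler_nat -sL; apply: ball_size_ge => // x /Hs; rewrite rootE.
Qed.

(** At radius 14 times the start [L] of a block only the branchings below [2 L]
    matter; the third factor [2 ^ L] absorbs the polynomial factor. *)
Lemma growth_small i : (0 < i)%N -> (h <= scale i)%N ->
  growth R c (14 * scale i) <= 2 `^ (3%:R / 14%:R).
Proof.
move=> i0 hi; have [s [sL Hs]] := canopy_ball_small phiK psiK phi_adj h (14 * scale i).
have L0 : (scale i)%:R != 0 :> R by rewrite pnatr_eq0 -lt0n expn_gt0.
have -> : 3%:R / 14%:R = (3 * scale i)%:R * (14 * scale i)%:R^-1 :> R.
  by rewrite !natrM invfM mulrACA mulfV // mulr1.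
rewrite powRrM powR_mulrn // -natrX; apply: ge0_ler_powR; rewrite ?nnegrE ?invr_ge0 //.
rewrite ler_nat; apply: (@leq_trans (size s)).
  by apply: ball_size_le => x; rewrite rootE => /Hs.
apply: (leq_trans sL); rewrite (_ : 3 * scale i = scale i + 2 * scale i)%N // expnD.
have hn : (h + 14 * scale i <= 16 * scale i)%N by lia.
apply: leq_mul; last first.
  rewrite leq_exp2l //; exact: leq_trans (level_leq hn) (level_flat i).
apply: leq_trans (_ : 16 * scale i < _)%N; first by rewrite ltnS.
have -> : (16 * scale i = 2 ^ (4 + 4 * i))%N by rewrite expnD.
rewrite ltn_exp2l // /scale; apply: (@leq_ltn_trans (4 * i + 4 * i)).
  by rewrite leq_add2r; lia.
case: i i0 {hi s sL Hs L0 hn} => // i _; elim: i => // i IHi.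
rewrite [X in (2 ^ X)%N]mulnS expnD; lia.
Qed.

(** The two exponents are 1/3 and 3/14, so the growth oscillates. *)
Lemma canopy_no_growth : ~ cvgn (growth R c).
Proof.
move=> /cvg_ex[l /cvgrPdist_lt cvl].
pose a : R := 2 `^ (3%:R^-1); pose b : R := 2 `^ (3%:R / 14%:R).
have ab : b < a.
  rewrite /a /b /powR gt_eqF // ltr_expR ltr_pM2r; first by lra.
  by apply: ln_gt0; lra.
have /cvl[N _ HN] : 0 < (a - b) / 2 by lra.
pose i := (h + N).+1.
have iL : (i < scale i)%N by apply: leq_trans (ltn_expl i (isT : 1 < 2)%N) _; rewrite leq_exp2l //; lia.
have /growth_large ga : (h <= 2 * scale i)%N by lia.
have /growth_small gb : (0 < i)%N by [].
have {}gb := gb (_ : h <= scale i)%N.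
have N3 : (N <= 3 * scale i)%N by lia.
have N14 : (N <= 14 * scale i)%N by lia.
have hs : (h <= scale i)%N by lia.
move: (HN _ N3) (HN _ N14) ga (gb hs) => /=; rewrite -/a -/b.
move: (growth R c (3 * scale i)) (growth R c (14 * scale i)) => x y.
rewrite !ltr_norml => /andP[h1 h2] /andP[h3 h4] ax yb.
by clear -ab h1 h2 h3 h4 ax yb; lra.
Qed.

End NoGrowth.

(** * A random root on the canopy tree *)
Lemma class_of_eq D k (M N : marked D k) : isomorphic M N ->
  class_of (marks M) = class_of (marks N).
Proof.
move=> MN; have Meta (L : marked D k) : L = Marked (marks L) by case: L.
by rewrite /class_of -!Meta; apply/eqmodP/asboolP.
Qed.

Lemma class_of_repr D k (G : graph D) (t : k.-tuple (vertex G)) :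
  isomorphic (Marked t) (repr (class_of t : iso_class D k)).
Proof.
have /eqmodP/asboolP : (repr (class_of t : iso_class D k) =
    Marked t %[mod iso_class D k])%qT by rewrite reprK.
exact: isomorphic_sym.
Qed.

Definition rooted_canopy (h : nat) : iso_space 3 1 :=
  class_of [tuple (vertex_of (h, 0%N) : vertex canopy)].

Definition canopy_pair (u v : nat * nat) : iso_space 3 2 :=
  class_of [tuple (vertex_of u : vertex canopy); vertex_of v].

Lemma canopy_pair_translate g u v :
  canopy_pair (translate g u) (translate g v) = canopy_pair u v.
Proof.
apply/esym; apply: (@class_of_eq 3 2 (Marked [tuple (vertex_of u : vertex canopy); vertex_of v])
  (Marked [tuple (vertex_of (translate g u) : vertex canopy); vertex_of (translate g v)])).
pose f (a : vertex canopy) : vertex canopy := vertex_of (translate g (coords a)).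
have fK : cancel f f by move=> a; rewrite /f vertex_ofK translateK coordsK.
exists f; split; first by exists f.
- by move=> a b; rewrite /= !vertex_ofK translate_adj.
- by apply: val_inj; rewrite /= /f !vertex_ofK.
Qed.

Lemma rooted_canopy_copy h : exists (phi : nat * nat -> vertex (rep_graph (rooted_canopy h)))
    (psi : vertex (rep_graph (rooted_canopy h)) -> nat * nat),
  [/\ cancel phi psi, cancel psi phi,
      forall u v, adj (phi u) (phi v) = canopy_adj u v,
      Defs.root (rooted_canopy h) = phi (h, 0%N) &
      forall u v, class_of [tuple phi u; phi v] = canopy_pair u v].
Proof.
have [f [[g fK gK] fadj fm]] := class_of_repr [tuple (vertex_of (h, 0%N) : vertex canopy)].
exists (fun v => f (vertex_of v)), (fun x => coords (g x)); split.
- by move=> v; rewrite fK vertex_ofK.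
- by move=> x; rewrite coordsK gK.
- by move=> u v; rewrite fadj /= !vertex_ofK.
- by rewrite /Defs.root /rooted_canopy -fm.
move=> u v; apply/esym.
apply: (@class_of_eq 3 2 (Marked [tuple (vertex_of u : vertex canopy); vertex_of v]) (Marked _)).
exists f; split=> //; first by exists g.
exact: val_inj.
Qed.

Section RandomCanopy.
Variable R : realType.
Local Open Scope ereal_scope.

(** Proportional to the frequency of the vertices of height [h] among the
    descendants of a high vertex. *)
Definition weight (h : nat) : R := (2 ^+ level h)^-1.

Lemma weight_ge0 h : (0 <= weight h)%R.
Proof. by rewrite invr_ge0 exprn_ge0. Qed.

(** Each value of the quotient is taken [m] times. *)
Lemma esum_divn (m : nat) (f : nat -> \bar R) : (0 < m)%N -> (forall y, 0 <= f y) ->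
  \esum_(g in [set: nat]) f (g %/ m)%N = m%:R%:E * \esum_(y in [set: nat]) f y.
Proof.
move=> m0 f0.
rewrite (reindex_esum (`I_m `*`` fun=> [set: nat]) setT
    (fun ry : nat * nat => ry.2 * m + ry.1)%N); last first.
  split=> //.
  - move=> [r y] [r' y'] /set_mem[/= rm _] /set_mem[/= rm' _] /= E.
    have : ((y * m + r) %/ m = (y' * m + r') %/ m)%N by rewrite E.
    rewrite !divnMDl // !divn_small // !addn0 => yy.
    by move: E; rewrite yy => /addnI ->.
  - move=> g _; exists (g %% m, g %/ m)%N; first by split=> //=; rewrite ltn_pmod.
    by rewrite /= -divn_eq.
rewrite -(esum_esum (a := fun r y => f ((y * m + r) %/ m)%N)) //.
rewrite (eq_esum (b := fun=> \esum_(y in [set: nat]) f y)); last first.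
  by move=> r /= rm; apply: eq_esum => y _; rewrite divnMDl // divn_small // addn0.
rewrite esum_fset //; last by move=> *; exact: esum_ge0.
by rewrite -fsbig_ord sumr_const card_ord mule_natl.
Qed.

Lemma sum_weight_lty : \sum_(0 <= h <oo) (weight h)%:E < +oo.
Proof.
pose f (j : nat) : \bar R := ((2 / (2 ^ j.+1)%:R)%R)%:E.
have f0 j : 0 <= f j by rewrite lee_fin divr_ge0.
have fsum : \sum_(0 <= j <oo) f j <= 2%:E by exact: epsilon_trick0.
apply: (@le_lt_trans _ _ (\sum_(0 <= h <oo) f (h %/ 32)%N)).
  apply: lee_nneseries => h _; rewrite lee_fin ?weight_ge0 // /weight.
  have -> : (2 / (2 ^ (h %/ 32).+1)%:R = (2 ^+ (h %/ 32))^-1 :> R)%R.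
    by rewrite natrX exprS invfM mulrA divff ?mul1r.
  rewrite lef_pV2 ?posrE ?exprn_gt0 //; apply: ler_weXn2l (level_ge h).
  by rewrite ler1n.
rewrite nneseries_esumT // esum_divn // -nneseries_esumT //.
by apply: (@le_lt_trans _ _ (32%:R%:E * 2%:E)); rewrite ?lee_pmul2l // -EFinM ltry.
Qed.

Definition weight_measure : {measure set nat -> \bar R} :=
  mseries (fun h => mscale (NngNum (weight_ge0 h)) \d_h) 0.

Lemma integral_weight (f : nat -> \bar R) : (forall h, 0 <= f h) ->
  \int[weight_measure]_h f h = \sum_(0 <= h <oo) (weight h)%:E * f h.
Proof.
move=> f0; rewrite ge0_integral_measure_series //.
apply: eq_eseriesr => h _; rewrite ge0_integral_mscale //.
by rewrite integral_dirac //= diracT mul1e.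
Qed.

Definition root_law : probability nat R := mnormalize weight_measure \d_0%N.

Lemma integral_root_law : exists z : {nonneg R}, forall f : nat -> \bar R,
  (forall h, 0 <= f h) ->
  \int[root_law]_h f h = z%:num%:E * \sum_(0 <= h <oo) (weight h)%:E * f h.
Proof.
have totE : weight_measure setT = \sum_(0 <= h <oo) (weight h)%:E.
  by apply: eq_eseriesr => h _; rewrite -[LHS]/((weight h)%:E * dirac h setT) diracT mule1.
have tot_lty : weight_measure setT < +oo by rewrite totE sum_weight_lty.
have tot_gt0 : 0 < weight_measure setT.
  rewrite totE; apply: (@lt_le_trans _ _ (weight 0)%:E).
    by rewrite lte_fin invr_gt0 exprn_gt0.
  have := @nneseries_lim_ge R (fun h => (weight h)%:E) xpredT 0 1.
  by rewrite big_nat1; apply=> h _ _; rewrite lee_fin weight_ge0.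
have z0 : (0 <= (fine (weight_measure setT))^-1)%R by rewrite invr_ge0 fine_ge0 // ltW.
exists (NngNum z0) => f f0.
rewrite -integral_weight // -ge0_integral_mscale //.
congr (integral _ _ _); apply/funext => U.
by rewrite /root_law /= /mnormalize gt_eqF //= lt_eqF //= /mscale /= muleC.
Qed.

Lemma rooted_canopy_measurable : measurable_fun [set: nat] rooted_canopy.
Proof. by []. Qed.

HB.instance Definition _ :=
  isMeasurableFun.Build _ _ nat (iso_space 3 1) rooted_canopy rooted_canopy_measurable.

Definition random_canopy : {RV root_law >-> iso_space 3 1} := rooted_canopy.

Section MassTransportCanopy.
Variable F : iso_space 3 2 -> \bar R.
Hypothesis F0 : forall c, 0 <= F c.

Let sent h k := \esum_(y in [set: nat]) F (canopy_pair (h, 0%N) (k, y)).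
Let received h k := \esum_(y in [set: nat]) F (canopy_pair (h, y) (k, 0%N)).

Let sent_ge0 h k : 0 <= sent h k. Proof. exact: esum_ge0. Qed.
Let received_ge0 h k : 0 <= received h k. Proof. exact: esum_ge0. Qed.

(** Both sides count the translations [g] applied to the pair of spine vertices at
    heights [h] and [k]: [g] moves the second vertex in one reading and the first
    one in the other, and each image is hit [2 ^ level] times. *)
Lemma level_transport h k : (weight h)%:E * sent h k = (weight k)%:E * received h k.
Proof.
have E : (2 ^ level k)%:R%:E * sent h k = (2 ^ level h)%:R%:E * received h k.
  rewrite /sent -(esum_divn (f := fun y => F (canopy_pair (h, 0%N) (k, y)))) ?expn_gt0 //.
  rewrite /received -(esum_divn (f := fun y => F (canopy_pair (h, y) (k, 0%N)))) ?expn_gt0 //.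
  apply: eq_esum => g _; rewrite -(canopy_pair_translate g).
  by rewrite translate_spine translate_to_spine.
have wE j : (weight j * (2 ^ level j)%:R = 1)%R.
  by rewrite natrX mulVf // expf_neq0.
have normalize j (x : \bar R) : x = (weight j)%:E * ((2 ^ level j)%:R%:E * x).
  by rewrite muleA -EFinM wE mul1e.
by rewrite (normalize k (sent h k)) (normalize h (received h k)) E muleCA.
Qed.

Let esum_levels (f : nat * nat -> \bar R) : (forall v, 0 <= f v) ->
  \esum_(v in [set: nat * nat]) f v =
  \sum_(0 <= k <oo) \esum_(y in [set: nat]) f (k, y).
Proof.
move=> f0; rewrite nneseries_esumT; last by move=> k; exact: esum_ge0.
rewrite (esum_esum (a := fun k y => f (k, y))) //.
have -> : ([set: nat] `*`` fun=> [set: nat]) = [set: nat * nat].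
  by apply/seteqP; split.
by apply: eq_esum => -[].
Qed.

Lemma sentE h :
  \esum_(x in [set: vertex (rep_graph (rooted_canopy h))])
    F (class_of [tuple Defs.root (rooted_canopy h); x]) = \sum_(0 <= k <oo) sent h k.
Proof.
have [phi [psi [phiK psiK _ -> phi_pair]]] := rooted_canopy_copy h.
rewrite (reindex_esum setT setT phi); last first.
  by split=> // [u v _ _ /(can_inj phiK)|x _] //; exists (psi x).
under eq_esum do rewrite phi_pair.
exact: (esum_levels (f := fun v => F (canopy_pair (h, 0%N) v))).
Qed.

Lemma receivedE k :
  \esum_(x in [set: vertex (rep_graph (rooted_canopy k))])
    F (class_of [tuple x; Defs.root (rooted_canopy k)]) = \sum_(0 <= h <oo) received h k.
Proof.
have [phi [psi [phiK psiK _ -> phi_pair]]] := rooted_canopy_copy k.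
rewrite (reindex_esum setT setT phi); last first.
  by split=> // [u v _ _ /(can_inj phiK)|x _] //; exists (psi x).
under eq_esum do rewrite phi_pair.
exact: (esum_levels (f := fun v => F (canopy_pair v (k, 0%N)))).
Qed.

Lemma canopy_transport :
  \sum_(0 <= h <oo) (weight h)%:E * \sum_(0 <= k <oo) sent h k =
  \sum_(0 <= k <oo) (weight k)%:E * \sum_(0 <= h <oo) received h k.
Proof.
transitivity (\sum_(0 <= h <oo) \sum_(0 <= k <oo) (weight k)%:E * received h k).
  apply: eq_eseriesr => h _; rewrite -nneseriesZl //.
  by apply: eq_eseriesr => k _; exact: level_transport.
rewrite nneseries_interchange; last first.
  by move=> h k; rewrite mule_ge0 // lee_fin weight_ge0.
by apply: eq_eseriesr => k _; rewrite nneseriesZl.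
Qed.

End MassTransportCanopy.

Lemma random_canopy_unimodular : unimodular random_canopy.
Proof.
move=> F _ F0 sent received _; rewrite /sent /received.
have [z zE] := integral_root_law.
rewrite !zE; try by move=> h; exact: esum_ge0.
congr (_ * _); under eq_eseriesr do rewrite sentE //.
under [RHS]eq_eseriesr do rewrite receivedE //.
exact: canopy_transport.
Qed.

Lemma random_canopy_tree : unimodular_tree random_canopy.
Proof.
split; first exact: random_canopy_unimodular.
apply: aeW => h; have [phi [psi [phiK psiK phi_adj _ _]]] := rooted_canopy_copy h.
exact: canopy_tree psiK phi_adj.
Qed.

Lemma random_canopy_one_ended h : one_ended (random_canopy h).
Proof.
have [phi [psi [phiK psiK phi_adj _ _]]] := rooted_canopy_copy h.
exact: canopy_one_ended phiK psiK phi_adj.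
Qed.

Lemma random_canopy_no_growth h : ~ cvgn (growth R (random_canopy h)).
Proof.
have [phi [psi [phiK psiK phi_adj rootE _]]] := rooted_canopy_copy h.
exact: canopy_no_growth phiK psiK phi_adj rootE.
Qed.

End RandomCanopy.

Theorem theorem4 (R : realType) :
  (forall (d : nat) (disp : measure_display) (Omega : measurableType disp)
          (P : probability Omega R) (T : {RV P >-> iso_space d 1}),
     unimodular_tree T -> hyperfinite_tree T ->
     ({ae P, forall w, two_ended (T w)} ->
        {ae P, forall w, growth R (T w) @ \oo --> (1 : R)})
     /\
     ({ae P, forall w, one_ended (T w)} ->
        {ae P, forall w,
          (limn_esup (fun n => (growth R (T w) n)%:E)
             <= (Num.sqrt (d%:R - 1))%:E)%E}))
  /\
  (exists (d : nat) (disp : measure_display) (Omega : measurableType disp)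
          (P : probability Omega R) (T : {RV P >-> iso_space d 1}),
     [/\ unimodular_tree T, hyperfinite_tree T,
         {ae P, forall w, one_ended (T w)} &
         {ae P, forall w, ~ cvgn (growth R (T w))}]).
Proof.
split=> [d disp Omega P T uniT _|].
  by split; [exact: two_ended_growth|exact: one_ended_growth].
exists 3, default_measure_display, nat, (root_law R), (random_canopy R); split.
- exact: random_canopy_tree.
- by apply: aeW => h; left; exact: random_canopy_one_ended.
- by apply: aeW => h; exact: random_canopy_one_ended.
- by apply: aeW => h; exact: random_canopy_no_growth.
Qed.
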